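(* Let $b>0$, $n\in\mathbb{N}$, let $0=\alpha_0<\alpha_1<\dots<\alpha_n$ be real numbers, and let $\mathcal{F}=\{x^{\alpha_i}\}_{i=0}^n$. Then for any $f=\sum_{i=0}^n a_i x^{\alpha_i}\in\operatorname{lin}\mathcal{F}$ with $f>0$ on $[0,b]$ and $a_n>0$ there exists a unique decomposition $$f=f_*+f^*$$ with $f_*,f^*\in\operatorname{lin}\mathcal{F}$ such that (i) for $n=2m$ there exist points $x_1,\dots,x_m,y_1,\dots,y_{m-1}\in[0,b]$ with $0<x_1<y_1<\dots<y_{m-1}<x_m<b$ and constants $c_*,c^*>0$ with $$f_*(x)=c_*\cdot\det\begin{pmatrix} x^{\alpha_0}&x^{\alpha_1}&x^{\alpha_2}&\dots&x^{\alpha_{2m-1}}&x^{\alpha_{2m}}\\ x&(x_1&x_1)&\dots&(x_m&x_m)\end{pmatrix}\ge 0$$ and $$f^*(x)=-c^*\cdot\det\begin{pmatrix} x^{\alpha_0}&x^{\alpha_1}&x^{\alpha_2}&x^{\alpha_3}&\dots&x^{\alpha_{2m-2}}&x^{\alpha_{2m-1}}&x^{\alpha_{2m}}\\ x&0&(y_1&y_1)&\dots&(y_{m-1}&y_{m-1})&b\end{pmatrix}\ge 0$$ for all $x\in[0,b]$; or (ii) for $n=2m+1$ there exist points $x_1,\dots,x_m,y_1,\dots,y_m\in[0,b]$ with $0<y_1<x_1<\dots<y_m<x_m<b$ and constants $c_*,c^*>0$ with $$f_*(x)=-c_*\cdot\det\begin{pmatrix} x^{\alpha_0}&x^{\alpha_1}&x^{\alpha_2}&x^{\alpha_3}&\dots&x^{\alpha_{2m}}&x^{\alpha_{2m+1}}\\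 x&0&(x_1&x_1)&\dots&(x_m&x_m)\end{pmatrix}\ge 0$$ and $$f^*(x)=c^*\cdot\det\begin{pmatrix} x^{\alpha_0}&x^{\alpha_1}&x^{\alpha_2}&\dots&x^{\alpha_{2m-1}}&x^{\alpha_{2m}}&x^{\alpha_{2m+1}}\\ x&(y_1&y_1)&\dots&(y_m&y_m)&b\end{pmatrix}\ge 0$$ for all $x\in[0,b]$.
   Context: $\operatorname{lin}\mathcal{F}$ is the real vector space of finite linear combinations of the functions in $\mathcal{F}$. $x^{0}$ is the constant function $1$ (also at $x=0$), and $0^{\alpha}=0$ for $\alpha>0$. Matrix notation: for functions $g_0,\dots,g_n$ and points $z_0,\dots,z_n$, $\begin{pmatrix} g_0&\dots&g_n\\ z_0&\dots&z_n\end{pmatrix}$ denotes the $(n+1)\times(n+1)$ matrix whose row belonging to the point $z_k$ is $(g_0(z_k),\dots,g_n(z_k))$. A bracketed pair $(z\ \ z)$ in the bottom line stands for two consecutive rows: $(g_0(z),\dots,g_n(z))$ followed by the row of derivatives $(g_0'(z),\dots,g_n'(z))$. In the top line $x^{\alpha_i}$ denotes the function $t\mapsto t^{\alpha_i}$; the bottom-line entry $x$ is the variable point at which $f_*$ or $f^*$ is evaluated. The uniqueness refers to decompositions with the stated properties. *)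

(* Defs.v *)
From HB Require Import structures.
From mathcomp Require Import all_boot all_order all_algebra.
From mathcomp Require Import all_classical all_reals all_analysis.
Set Implicit Arguments.
Unset Strict Implicit.
Unset Printing Implicit Defensive.
Import Order.TTheory GRing.Theory Num.Theory.
Import numFieldNormedType.Exports.
Local Open Scope ring_scope.

(* [powR] satisfies 0 `^ 0 = 1 and 0 `^ a = 0 for a != 0.  On negative
   arguments [monom a] is the constant 1, a junk value. *)
Definition monom (R : realType) (a : R) : R -> R := fun t => t `^ a.

Definition lin (R : realType) (n : nat) (g : 'I_n.+1 -> R -> R) :
    set (R -> R) :=
  [set h | exists a : 'I_n.+1 -> R, forall t, h t = \sum_(i < n.+1) a i * g i t]%classic.

(* The bottom line of the matrix is coded by one pair (z, k) per row, standing
   for the row of k-th derivatives at z; thus a point z is [:: (z, 0)] and a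
   bracketed pair (z z) is [:: (z, 0); (z, 1)]. *)
Definition pt (R : realType) (z : R) : seq (R * nat) := [:: (z, 0%N)].

Definition dpt (R : realType) (z : R) : seq (R * nat) :=
  [:: (z, 0%N); (z, 1%N)].

(* (p_1 p_1) ... (p_m p_m); the sequence p is indexed from 1. *)
Definition dpts (R : realType) (p : nat -> R) (m : nat) : seq (R * nat) :=
  flatten [seq dpt (p k) | k <- iota 1 m].

(* Meant for a bottom line s with exactly n.+1 rows; the default value of
   [nth] is then never used. *)
Definition ptmx (R : realType) (n : nat) (g : 'I_n.+1 -> R -> R)
    (s : seq (R * nat)) : 'M[R]_n.+1 :=
  \matrix_(k < n.+1, i < n.+1)
    derive1n (nth (0, 0%N) s k).2 (g i) (nth (0, 0%N) s k).1.

(* p_1, q_1, p_2, q_2, ..., p_m, q_m *)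
Definition alternate (R : realType) (p q : nat -> R) (m : nat) : seq R :=
  flatten [seq [:: p k; q k] | k <- iota 1 m].

(* Main.v *)
Require Import Defs.
From HB Require Import structures.
From mathcomp Require Import all_boot all_order all_algebra.
From mathcomp Require Import all_classical all_reals all_analysis.
From mathcomp Require Import zify ring lra.
Import Order.TTheory GRing.Theory Num.Theory.
Import numFieldNormedType.Exports.
Local Open Scope ring_scope.
Set Implicit Arguments.
Unset Strict Implicit.

(** Write V for the span of the t^(alpha_i). The lower part f_lo turns out to be
    the function p with the largest leading coefficient among all p in V with
    0 <= p <= f on [0, b]; it oscillates between 0 and f, and f_up = f - p.

    - Total positivity. A function in V with n zeros (counted with
      multiplicity, at most two) and positive leading coefficient is positive to
      the right of them: Rolle's theorem passes to t^(1 - alpha_1) p', which has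
      one exponent less ([peval_last_gt0]). Expanding along the last row, every
      collocation determinant on increasing nodes, with rows of derivatives
      at doubled nodes, is positive ([det_rowmx_gt0]).

    - Uniqueness. By Cramer's rule the leading coefficient of h in V is an
      alternating combination, with positive weights, of the values of h at n+1
      increasing points. Hence if p equals f and 0 alternately at n+1 points, f at
      the last, then every q in V with 0 <= q <= f has a leading coefficient at
      most that of p, and equality forces q = p ([snake_extremal]). In every
      decomposition f_lo is such a p, the contact points being 0, the x_i, the
      y_i and b; so two decompositions have the same f_lo.

    - Existence. The set of competitors is compact, so a maximiser p exists
      ([in_band_max_coef]). If the closed sets where p = f and where p = 0 did
      not alternate n+1 times, at most n points would separate them
      ([separators]), some h in V would be negative on the first set and
      positive on the second with leading coefficient >= 0 ([separating_poly]),
      and p + d h would leave room for increasing the leading coefficient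
      ([extremal_alternates]). This gives contact points w_0 < ... < w_n.

    - Shape. Interior contact points are double zeros of p or of f - p. Counting
      them, w_0 > 0 or w_n < b would give a nonzero function n+1 zeros
      ([bottom_node], [top_node]). Cramer's rule with the variable point as
      first row turns the n zeros into the determinant formulas
      ([peval_ptmx]), and the sign of one further value, that of p at b and of
      f - p at w_(n-1), gives the sign of the constants ([insert_row_sign]). *)

(** * Generalised polynomials with real exponents *)

Definition exponents (R : realType) n (al : 'I_n.+1 -> R) :=
  al ord0 = 0 /\ forall i j : 'I_n.+1, (i < j)%N -> al i < al j.

(** The entry of a row (z, d) under the exponent e: the value at z for d = 0, and the
    derivative at z > 0 otherwise, written out so that no analysis is needed to
    handle the matrices. *)
Definition monrow (R : realType) (e : R) (zd : R * nat) : R :=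
  if zd.2 == 0%N then zd.1 `^ e else e * zd.1 `^ (e - 1).

Definition peval (R : realType) n (al a : 'I_n -> R) (zd : R * nat) : R :=
  \sum_(i < n) a i * monrow (al i) zd.

Lemma exponents_ge0 (R : realType) n (al : 'I_n.+1 -> R) :
  exponents al -> forall i, 0 <= al i.
Proof.
move=> [al0 ali] i; have [->|i0] := eqVneq i ord0; first by rewrite al0.
by rewrite -al0 ltW// ali// lt0n.
Qed.

Lemma exponents_widen (R : realType) n (al : 'I_n.+2 -> R) :
  exponents al -> exponents (al \o lift ord_max).
Proof.
move=> [al0 ali]; split=> [|i j ij] /=.
  by rewrite -al0; congr al; apply: val_inj.
by apply: ali; rewrite !lift_max.
Qed.

(** Powers jump at 0 when approached from negative arguments, where their value
    is 1; truncating the argument makes them continuous on the whole line. *)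
Lemma powR_max0_continuous (R : realType) (e : R) :
  0 <= e -> continuous (fun t : R => (Num.max t 0) `^ e).
Proof.
rewrite le_eqVlt => /predU1P[<-|e0] t.
  under eq_fun do rewrite powRr0.
  exact: cvg_cst.
have [t0|t0|->] := ltgtP t 0.
- apply: cvg_near_cst; near=> s.
  rewrite !max_r ?(ltW t0)//; apply: ltW; near: s; exact: lt_nbhsl.
- have dt := is_derive1_powR e t0.
  have ct : {for t, continuous (fun s : R => s `^ e)}.
    by apply/differentiable_continuous; rewrite -derivable1_diffP.
  rewrite /prop_for /continuous_at in ct.
  rewrite /continuous_at (max_l (ltW t0)); apply: cvg_trans ct; apply: near_eq_cvg.
  near=> s; rewrite max_l//; apply: ltW; near: s; exact: lt_nbhsr.
- apply/left_right_continuousP; rewrite /continuous_at maxxx powR0 ?gt_eqF//; split.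
    apply: cvg_near_cst; near=> s.
    by rewrite max_r ?powR0 ?gt_eqF//; near: s; apply: nbhs_left_le.
  apply: cvg_trans (powR_cvg0 e0); apply: near_eq_cvg.
  by near=> s; rewrite max_l.
Unshelve. all: by end_near. Qed.

Lemma peval_max0_continuous (R : realType) n (al a : 'I_n.+1 -> R) :
  exponents al -> continuous (fun t : R => peval al a (Num.max t 0, 0%N)).
Proof.
move=> hal t; apply: cvg_big => [|i _]; first exact: add_continuous.
apply: cvgM; first exact: cvg_cst.
exact/powR_max0_continuous/exponents_ge0.
Qed.

Lemma peval_within_continuous (R : realType) n (al a : 'I_n.+1 -> R) (x y : R) :
  exponents al -> 0 <= x ->
  {within `[x, y], continuous (fun t : R => peval al a (t, 0%N))}%classic.
Proof.
move=> hal x0.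
apply: (@subspace_eq_continuous _ _ _ (fun t : R => peval al a (Num.max t 0, 0%N))).
  move=> t; rewrite inE/= in_itv/= => /andP[xt _].
  by rewrite max_l// (le_trans x0).
exact/continuous_subspaceT/peval_max0_continuous.
Qed.

Lemma peval_is_derive (R : realType) n (al a : 'I_n -> R) (t : R) : 0 < t ->
  is_derive t 1 (fun s : R => peval al a (s, 0%N)) (peval al a (t, 1%N)).
Proof.
move=> t0.
rewrite (_ : (fun s => _) = \sum_(i < n) (a i \*: (fun s : R => s `^ al i)))//.
  apply: is_derive_sum => i; apply: is_deriveZ; exact: is_derive1_powR.
by apply/funext => s; rewrite /peval fct_sumE.
Qed.

(** * Zeros beyond which the leading term decides the sign *)

(** [shift_exp] and [shift_coef] describe t^(1 - al_1) p'(t): differentiation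
    kills the constant term, and dividing by the smallest power left makes the
    exponents start at 0 again, with one exponent less. *)
Definition shift_exp (R : realType) n (al : 'I_n.+2 -> R) (i : 'I_n.+1) : R :=
  al (lift ord0 i) - al (lift ord0 ord0).

Definition shift_coef (R : realType) n (al a : 'I_n.+2 -> R) (i : 'I_n.+1) : R :=
  a (lift ord0 i) * al (lift ord0 i).

Lemma exponents_shift (R : realType) n (al : 'I_n.+2 -> R) :
  exponents al -> exponents (shift_exp al).
Proof.
move=> [_ ali]; split=> [|i j ij]; first by rewrite /shift_exp subrr.
by rewrite /shift_exp ltrD2r; apply: ali; rewrite !lift0.
Qed.

Lemma peval_derivE (R : realType) n (al a : 'I_n.+2 -> R) (t : R) :
  exponents al -> 0 < t ->
  peval al a (t, 1%N) = t `^ (al (lift ord0 ord0) - 1) *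
    peval (shift_exp al) (shift_coef al a) (t, 0%N).
Proof.
move=> [al0 _] t0; rewrite /peval big_ord_recl /monrow /= al0 mul0r mulr0 add0r.
rewrite mulr_sumr; apply: eq_bigr => i _; rewrite /shift_coef /shift_exp.
rewrite mulrA mulrCA -powRD; last by rewrite (gt_eqF t0) implybT.
by congr (_ * _ `^ _); ring.
Qed.

(** A row is followed either by the value row of a larger point or by the
    derivative row of the same point. Derivative rows are confined to positive
    points, since powers need not be differentiable at 0. *)
Definition row_next (R : realType) (p q : R * nat) : Prop :=
  (q.2 = 0%N /\ p.1 < q.1) \/ [/\ q.2 = 1%N, q.1 = p.1, p.2 = 0%N & 0 < p.1].

Definition sorted_rows (R : realType) (r : nat -> R * nat) (N : nat) : Prop :=
  [/\ 0 <= (r 0%N).1, (r 0%N).2 = 0%N &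
      forall k, (k.+1 < N)%N -> row_next (r k) (r k.+1)].

Lemma sorted_rows_ge0 (R : realType) (r : nat -> R * nat) N k :
  sorted_rows r N -> (k < N)%N -> 0 <= (r k).1.
Proof.
move=> [r0 _ rn]; elim: k => [//|k IHk] kN.
have {}IHk := IHk (ltnW kN).
by have [[_ /ltW]|[_ -> _ _]] := rn _ kN => //; apply: le_trans.
Qed.

Lemma sorted_rows_value (R : realType) n (al a : 'I_n.+1 -> R)
    (r : nat -> R * nat) N M k :
  sorted_rows r N -> (M <= N)%N -> (forall j, (j < M)%N -> peval al a (r j) = 0) ->
  (k < M)%N -> peval al a ((r k).1, 0%N) = 0.
Proof.
move=> [_ d0 rn] MN rz kM; case: k kM => [|k] kM.
  by rewrite -(rz _ kM); case: (r 0%N) d0 => z d /= ->.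
have [[d _]|[_ -> d _]] := rn k (leq_trans kM MN).
  by rewrite -(rz _ kM); case: (r k.+1) d => z d' /= ->.
by rewrite -(rz k (ltnW kM)); case: (r k) d => z d' /= ->.
Qed.

(** Rolle's theorem for t^(1 - al_1) p', which has the same positive zeros
    as p'. *)
Lemma peval_rolle (R : realType) n (al a : 'I_n.+2 -> R) (x y : R) :
  exponents al -> 0 <= x -> x < y ->
  peval al a (x, 0%N) = 0 -> peval al a (y, 0%N) = 0 ->
  exists2 w, x < w < y & peval (shift_exp al) (shift_coef al a) (w, 0%N) = 0.
Proof.
move=> hal x0 xy px py.
have dp s : s \in `]x, y[%R -> 0 < s.
  by rewrite in_itv/= => /andP[xs _]; apply: le_lt_trans xs.
have [|||w wxy dw] := @Rolle R (fun t : R => peval al a (t, 0%N)) x y xy.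
- by move=> s /dp s0; have := peval_is_derive al a s0; case.
- exact: peval_within_continuous.
- by rewrite px py.
have w0 := dp _ wxy; exists w; first by move: wxy; rewrite in_itv.
have /eqP := @derive_val _ _ _ _ _ _ _ (peval_is_derive al a w0).
rewrite (@derive_val _ _ _ _ _ _ _ dw) eq_sym peval_derivE// mulf_eq0.
by rewrite gt_eqF ?powR_gt0//= => /eqP.
Qed.

(** Between distinct neighbouring zeros of p by Rolle's theorem, and at its double
    zeros, t^(1 - al_1) p' vanishes: n-1 distinct zeros below the last row. By
    induction this function is positive beyond them, so p increases from its last
    zero; when the last row is a derivative row the conclusion is this positivity
    itself. *)
Lemma peval_last_gt0 (R : realType) n (al a : 'I_n.+1 -> R) (r : nat -> R * nat) :
  exponents al -> 0 < a ord_max -> sorted_rows r n.+1 ->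
  (forall k, (k < n)%N -> peval al a (r k) = 0) -> 0 < peval al a (r n).
Proof.
elim: n al a r => [|n IHn] al a r hal an hr rz.
  rewrite /peval big_ord1 /monrow; case: hr hal => _ -> _ [-> _].
  by rewrite /= powRr0 mulr1 (_ : ord0 = ord_max)//; apply: val_inj.
have [_ d0 rn] := hr.
have val0 k : (k <= n)%N -> peval al a ((r k).1, 0%N) = 0.
  by move=> kn; apply: (sorted_rows_value hr (leqnSn _)) => //.
have r_ge0 k : (k <= n.+1)%N -> 0 <= (r k).1.
  by move=> kn; apply: (sorted_rows_ge0 hr).
set al' := shift_exp al; set a' := shift_coef al a.
(* w i is a zero of the derivative between consecutive rows: the double zero
   itself, or a point given by Rolle's theorem. *)
have /choice[w hw] : forall i : nat, exists w : R, (i < n)%N ->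
    [/\ (r i).1 <= w, 0 < w, peval al' a' (w, 0%N) = 0 &
        ((r i.+1).2 = 0%N -> (r i).1 < w < (r i.+1).1) /\
        ((r i.+1).2 = 1%N -> w = (r i).1)].
  move=> i; have [ltin|_] := ltnP i n; last by exists 0.
  have i1 : (i.+1 < n.+2)%N by rewrite ltnS ltnW.
  have [[d lt_z]|[d eq_z di z0]] := rn i i1.
    have [w ww pw] := peval_rolle hal (r_ge0 _ (ltnW i1)) lt_z (val0 _ (ltnW ltin)) (val0 _ ltin).
    exists w => _; case/andP: (ww) => w1 w2; rewrite d; split=> //; first exact: ltW.
    by apply: le_lt_trans w1; apply: r_ge0; apply: ltnW.
  exists (r i).1 => _; rewrite d; split=> //.
  have /eqP := rz _ (ltin : (i.+1 < n.+1)%N).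
  rewrite [r i.+1]surjective_pairing d eq_z peval_derivE// mulf_eq0.
  by rewrite gt_eqF ?powR_gt0//= => /eqP.
have w_lt i : (i.+1 < n)%N -> w i < w i.+1.
  move=> ltin; have [w1 _ _ [w1a w1b]] := hw _ ltin.
  have [_ _ _ [w0a w0b]] := hw _ (ltnW ltin).
  have [|[d lt_z]|[d eq_z di z0]] := rn i; first by rewrite ltnS ltnW// ltnW.
    by have /andP[_ w2] := w0a d; apply: lt_le_trans w2 w1.
  rewrite (w0b d) -eq_z.
  have [|[d' _]|[_ _ d' _]] := rn i.+1; first by rewrite ltnS ltnW.
    by have /andP[] := w1a d'.
  by rewrite d in d'.
(* The induction hypothesis for the simple rows w 0, ..., w (n-1), c. *)
have key c : 0 < c -> (forall k, k.+1 = n -> w k < c) -> 0 < peval al' a' (c, 0%N).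
  move=> c0 wc.
  pose r' k := if (k < n)%N then (w k, 0%N) else (c, 0%N).
  have <- : r' n = (c, 0%N) by rewrite /r' ltnn.
  apply: IHn.
  - exact: exponents_shift.
  - have lm : lift ord0 ord_max = ord_max :> 'I_n.+2 by apply: val_inj.
    rewrite /a' /shift_coef lm mulr_gt0//.
    by case: hal => al0 ali; rewrite -al0; apply: ali.
  - split=> [||k kn]; rewrite /r'.
    + by case: ifP => [/hw[_ /ltW]|_] //=; apply: ltW.
    + by case: ifP.
    + left; move: kn; rewrite ltnS => kn; rewrite kn.
      have [lt_k|ge_k] := ltnP k.+1 n; first by split=> //; apply: w_lt.
      by split=> //; apply: wc; apply/eqP; rewrite eqn_leq kn.
  - by move=> k kn; rewrite /r' kn; case: (hw _ kn).
have [[d lt_z]|[d eq_z di z0]] := rn n (ltnSn _).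
  have dp s : s \in `](r n).1, (r n.+1).1[%R -> 0 < s.
    by rewrite in_itv/= => /andP[xs _]; apply: le_lt_trans xs; apply: r_ge0.
  have [||c cz] := @MVT R (fun t : R => peval al a (t, 0%N))
     (fun t => peval al a (t, 1%N)) _ _ lt_z.
  - by move=> s /dp s0; apply: peval_is_derive.
  - by apply: peval_within_continuous => //; apply: r_ge0.
  rewrite [peval _ _ ((r n).1, _)]val0// subr0 [r n.+1]surjective_pairing d /= => ->.
  have c0 := dp _ cz; rewrite mulr_gt0 ?subr_gt0// peval_derivE//.
  rewrite mulr_gt0 ?powR_gt0//; apply: key => //.
  move=> k kn; subst n; have [_ _ _ [wa wb]] := hw _ (ltnSn k).
  move: cz; rewrite in_itv/= => /andP[zc _]; apply: le_lt_trans zc.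
  have [|[d' _]|[d' e' _ _]] := rn k; first by rewrite ltnW.
    by have /andP[_ /ltW] := wa d'.
  by rewrite (wb d') e'.
rewrite [r n.+1]surjective_pairing d eq_z peval_derivE//.
rewrite mulr_gt0 ?powR_gt0//; apply: key => // k kn.
subst n; have [_ _ _ [wa _]] := hw _ (ltnSn k).
by have /andP[] := wa di.
Qed.

(** * Positivity of the confluent collocation determinants *)

Definition rowmx (R : realType) n (al : 'I_n -> R) (r : nat -> R * nat) : 'M[R]_n :=
  \matrix_(k < n, i < n) monrow (al i) (r k).

Lemma rowmx_cramer (R : realType) n (al a : 'I_n -> R) (r : nat -> R * nat) i :
  \det (rowmx al r) * a i =
  \sum_(k < n) cofactor (rowmx al r) k i * peval al a (r k).
Proof.
set M := rowmx al r; pose v : 'cV[R]_n := \col_j a j.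
have -> : \det M * a i = ((\det M)%:M *m v) i 0 by rewrite mul_scalar_mx !mxE.
rewrite -mul_adj_mx -mulmxA mxE; apply: eq_bigr => k _.
rewrite mxE; congr (_ * _); rewrite mxE; apply: eq_bigr => j _.
by rewrite !mxE mulrC.
Qed.

(** Deleting a row and the last column leaves a collocation matrix of the same
    kind, with one exponent less; this is what makes inductions work. *)
Lemma cofactor_rowmx_last (R : realType) n (al : 'I_n.+1 -> R)
    (r : nat -> R * nat) k :
  cofactor (rowmx al r) k ord_max =
  (-1) ^+ (k + n) * \det (rowmx (al \o lift ord_max) (r \o bump k)).
Proof.
by congr (_ * \det _); apply/matrixP => i j; rewrite !mxE.
Qed.

(** If all rows but one vanish on p, Cramer's rule links the value of p on that
    row to its leading coefficient. *)
Lemma rowmx_cramer_last (R : realType) n (al a : 'I_n.+1 -> R)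
    (r : nat -> R * nat) (k : 'I_n.+1) :
  (forall j : 'I_n.+1, j != k -> peval al a (r j) = 0) ->
  \det (rowmx al r) * a ord_max =
  (-1) ^+ (k + n) * \det (rowmx (al \o lift ord_max) (r \o bump k)) *
    peval al a (r k).
Proof.
move=> rz; rewrite rowmx_cramer (bigD1 k)//= big1 ?addr0 => [|j jk].
  by rewrite cofactor_rowmx_last.
by rewrite rz// mulr0.
Qed.

(** The cofactors of the last row are the coefficients of a function vanishing
    on all other rows: the corresponding determinant has two equal rows. *)
Lemma peval_cofactor_eq0 (R : realType) n (al : 'I_n.+1 -> R) (r : nat -> R * nat) k :
  (k < n)%N -> peval al (cofactor (rowmx al r) ord_max) (r k) = 0.
Proof.
move=> kn; pose k' : 'I_n.+1 := Ordinal (ltn_trans kn (ltnSn n)).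
have := mul_mx_adj (rowmx al r) => /(congr1 (fun A : 'M[R]_n.+1 => A k' ord_max)).
rewrite !mxE /= (_ : (k' == ord_max) = false); last first.
  by apply/negbTE; rewrite neq_ltn /= kn.
rewrite mulr0n => e0; rewrite -[RHS]e0; apply: eq_bigr => j _.
by rewrite !mxE mulrC.
Qed.

Lemma cofactor_rowmx_max (R : realType) n (al : 'I_n.+1 -> R) (r : nat -> R * nat) :
  cofactor (rowmx al r) ord_max ord_max = \det (rowmx (al \o lift ord_max) r).
Proof.
rewrite cofactor_rowmx_last /= exprD -expr2 sqrr_sign mul1r; congr (\det _).
by apply/matrixP => i j; rewrite !mxE /= /bump leqNgt ltn_ord.
Qed.

(** As a function of its last row the determinant lies in the span, vanishes on
    the other rows, and has as leading coefficient the determinant of the smaller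
    system, positive by induction; [peval_last_gt0] gives the sign. *)
Lemma det_rowmx_gt0 (R : realType) n (al : 'I_n.+1 -> R) (r : nat -> R * nat) :
  exponents al -> sorted_rows r n.+1 -> 0 < \det (rowmx al r).
Proof.
elim: n al => [|n IHn] al hal hr.
  rewrite [rowmx al r]mx11_scalar det_scalar1 mxE /monrow.
  by case: hr hal => _ -> _ [-> _]; rewrite /= powRr0.
have -> : \det (rowmx al r) = peval al (cofactor (rowmx al r) ord_max) (r n.+1).
  by rewrite (expand_det_row _ ord_max); apply: eq_bigr => j _; rewrite mxE mulrC.
apply: peval_last_gt0 => // [|k]; last exact: peval_cofactor_eq0.
rewrite cofactor_rowmx_max; apply: IHn; first exact: exponents_widen.
by have [r0 d0 rn] := hr; split=> // k kn; apply: rn; apply: ltnW.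
Qed.

Lemma peval_rows_eq0 (R : realType) n (al a : 'I_n.+1 -> R) (r : nat -> R * nat) :
  exponents al -> sorted_rows r n.+1 ->
  (forall k, (k < n.+1)%N -> peval al a (r k) = 0) -> forall i, a i = 0.
Proof.
move=> hal hr rz i; have := rowmx_cramer al a r i.
rewrite big1 => [/eqP|k _]; last by rewrite rz// mulr0.
by rewrite mulf_eq0 gt_eqF ?det_rowmx_gt0//= => /eqP.
Qed.

(** * Alternation maximises the leading coefficient *)

Lemma increasing_lt (R : realType) (w : nat -> R) n :
  (forall k, (k < n)%N -> w k < w k.+1) ->
  forall i j, (i < j <= n)%N -> w i < w j.
Proof.
move=> wi i j; elim: j => [//|j IHj] /andP[]; rewrite ltnS leq_eqVlt.
move=> /predU1P[->|ij] jn; first exact: wi.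
by apply: lt_trans (wi _ jn); apply: IHj; rewrite ij ltnW.
Qed.

Lemma increasing_within (R : realType) (w : nat -> R) n (b : R) k :
  0 <= w 0%N -> w n <= b -> (forall k, (k < n)%N -> w k < w k.+1) ->
  (k <= n)%N -> 0 <= w k <= b.
Proof.
move=> w0 wn wi kn; have wlt := increasing_lt wi; apply/andP; split.
  case: k kn => [//|k] kn; apply: le_trans w0 (ltW (wlt _ _ _)).
  by rewrite kn.
move: kn; rewrite leq_eqVlt => /predU1P[->//|kn].
by apply: le_trans (ltW (wlt _ _ _)) wn; rewrite kn /=.
Qed.

Lemma det_rowmx_widen_gt0 (R : realType) n (al : 'I_n.+1 -> R) (r : nat -> R * nat) :
  exponents al -> sorted_rows r n -> 0 < \det (rowmx (al \o lift ord_max) r).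
Proof.
case: n al => [|n] al hal hr; first by rewrite det_mx00.
by apply: det_rowmx_gt0; first exact: exponents_widen.
Qed.

Lemma pevalB (R : realType) n (al a a' : 'I_n -> R) zd :
  peval al (fun i => a i - a' i) zd = peval al a zd - peval al a' zd.
Proof. by rewrite -sumrB; apply: eq_bigr => i _; rewrite mulrBl. Qed.

Definition simple_rows (R : realType) (w : nat -> R) (k : nat) : R * nat := (w k, 0%N).

Lemma simple_rows_sorted (R : realType) (w : nat -> R) N :
  0 <= w 0%N -> (forall k, (k.+1 < N)%N -> w k < w k.+1) ->
  sorted_rows (simple_rows w) N.
Proof. by move=> w0 wi; split=> // k kN; left; split=> //; apply: wi. Qed.

Lemma simple_minor_gt0 (R : realType) n (al : 'I_n.+1 -> R) (w : nat -> R) (k : nat) :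
  exponents al -> 0 <= w 0%N -> (forall k, (k < n)%N -> w k < w k.+1) ->
  0 < \det (rowmx (al \o lift ord_max) (simple_rows w \o bump k)).
Proof.
move=> hal w0; case: n al hal => [|n] al hal wi; first by rewrite det_mx00.
have wlt := increasing_lt wi.
have -> : simple_rows w \o bump k = simple_rows (w \o bump k) by [].
apply: det_rowmx_widen_gt0 => //; apply: simple_rows_sorted => [|j jn] /=.
  rewrite /bump addn0; case: (k <= 0)%N => //.
  by apply: le_trans (ltW (wi _ _)).
apply: wlt; rewrite /bump; case: (leqP k j) => kj.
  by rewrite leqW// !add1n ltnS leqnn ltnS.
by rewrite add0n (leq_trans (leqnn j.+1) (leq_addl _ _)); case: (k <= j.+1)%N; lia.
Qed.

(** Apply Cramer's rule to d = p - q, with p and q the functions of coefficients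
    a and a'. The terms of the expansion of the leading coefficient of d are
    the products of positive minors and of the numbers (-1)^(k+n) d(w_k), which
    are >= 0 because q lies between 0 and f while p touches f and 0 alternately. *)
Lemma snake_extremal (R : realType) n (al a a' : 'I_n.+1 -> R) (f : R -> R)
    (w : nat -> R) :
  exponents al -> 0 <= w 0%N -> (forall k, (k < n)%N -> w k < w k.+1) ->
  (forall k, (k <= n)%N ->
     peval al a (w k, 0%N) = if odd (k + n) then 0 else f (w k)) ->
  (forall k, (k <= n)%N -> 0 <= peval al a' (w k, 0%N) <= f (w k)) ->
  a' ord_max <= a ord_max /\
  (a' ord_max = a ord_max -> forall i, a i = a' i).
Proof.
move=> hal w0 wi pw pw'.
have hr : sorted_rows (simple_rows w) n.+1 by apply: simple_rows_sorted.
pose d i := a i - a' i.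
have d_ge0 (k : 'I_n.+1) : 0 <= (-1) ^+ (k + n) * peval al d (simple_rows w k).
  rewrite pevalB /simple_rows pw -1?ltnS//; have /andP[p0 p1] := pw' k (ltn_ord k).
  by rewrite -signr_odd; case: odd; rewrite ?expr0 ?expr1; lra.
have dE : \det (rowmx al (simple_rows w)) * d ord_max =
    \sum_(k < n.+1) \det (rowmx (al \o lift ord_max) (simple_rows w \o bump k)) *
      ((-1) ^+ (k + n) * peval al d (simple_rows w k)).
  rewrite rowmx_cramer; apply: eq_bigr => k _.
  by rewrite cofactor_rowmx_last [_ ^+ _ * \det _]mulrC mulrA.
have D0 := det_rowmx_gt0 hal hr.
have T_ge0 (k : 'I_n.+1) : true ->
    0 <= \det (rowmx (al \o lift ord_max) (simple_rows w \o bump k)) *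
      ((-1) ^+ (k + n) * peval al d (simple_rows w k)).
  by move=> _; apply: mulr_ge0 => //; apply/ltW/simple_minor_gt0.
split=> [|eq_max i].
  by rewrite -subr_ge0 -/(d ord_max) -(pmulr_rge0 _ D0) dE sumr_ge0.
apply/eqP; rewrite -subr_eq0; apply/eqP; rewrite -/(d i).
apply: (peval_rows_eq0 hal hr) => k kn.
have := dE; rewrite /d eq_max subrr mulr0 => /esym/(psumr_eq0P T_ge0).
move=> /(_ (Ordinal kn) isT)/eqP; rewrite mulf_eq0 gt_eqF ?simple_minor_gt0//=.
by rewrite mulf_eq0 signr_eq0 => /eqP.
Qed.

Definition in_band (R : realType) n (al : 'I_n.+1 -> R) (f : R -> R) (b : R)
    (a : 'I_n.+1 -> R) :=
  forall t, 0 <= t <= b -> 0 <= peval al a (t, 0%N) <= f t.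

(** Coefficients are recovered from n+1 values by Cramer's rule. *)
Lemma in_band_coef_bounded (R : realType) n (al : 'I_n.+1 -> R) (f : R -> R) (b : R) :
  exponents al -> 0 < b ->
  exists B, forall a, in_band al f b a -> forall i, `|a i| <= B.
Proof.
move=> hal b0; pose w (k : nat) := b * (k%:R / n.+1%:R).
have wi k : (k < n)%N -> w k < w k.+1.
  by move=> _; rewrite ltr_pM2l// ltr_pM2r ?invr_gt0 ?ltr0n// ltr_nat.
have w0 : 0 <= w 0%N by rewrite /w mul0r mulr0.
have D0 : 0 < \det (rowmx al (simple_rows w)).
  by apply: det_rowmx_gt0 => //; apply: simple_rows_sorted.
have wb (k : 'I_n.+1) : 0 <= w k <= b.
  rewrite mulr_ge0 ?(ltW b0) ?divr_ge0//= ler_piMr ?(ltW b0)//.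
  by rewrite ler_pdivrMr ?ltr0n// mul1r ler_nat ltnW.
pose B i := (\sum_(k < n.+1) `|cofactor (rowmx al (simple_rows w)) k i| * f (w k)) /
  \det (rowmx al (simple_rows w)).
have B0 a i : in_band al f b a -> `|a i| <= B i.
  move=> ha; rewrite ler_pdivlMr// mulrC -{1}(gtr0_norm D0) -normrM rowmx_cramer.
  apply: le_trans (ler_norm_sum _ _ _) _; apply: ler_sum => k _.
  rewrite normrM ler_wpM2l//; have /andP[p0 p1] := ha _ (wb k).
  by rewrite ger0_norm.
exists (\sum_i `|B i|) => a ha i; apply: le_trans (B0 _ i ha) _.
rewrite (bigD1 i)//=; apply: le_trans (ler_norm _) _.
by rewrite lerDl sumr_ge0.
Qed.

Lemma in_band_max_coef (R : realType) n (al : 'I_n.+1 -> R) (f : R -> R) (b : R) :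
  exponents al -> 0 < b -> (forall t, 0 <= t <= b -> 0 <= f t) ->
  exists2 a, in_band al f b a &
    forall a', in_band al f b a' -> a' ord_max <= a ord_max.
Proof.
move=> hal b0 f0.
pose K : set 'rV[R]_n.+1 := [set v | in_band al f b (v ord0)]%classic.
have peval_cont t : continuous (fun v : 'rV[R]_n.+1 => peval al (v ord0) (t, 0%N)).
  apply: continuous_big => [|i _ v]; first exact: add_continuous.
  apply: (@cvgM _ _ (nbhs v) _ (fun v : 'rV[R]_n.+1 => v ord0 i)).
    exact: coord_continuous.
  exact: cvg_cst.
have Kcl : closed K.
  rewrite (_ : K = \bigcap_(t in [set t | 0 <= t <= b])
     ((fun v : 'rV[R]_n.+1 => peval al (v ord0) (t, 0%N)) @^-1` [set y | (0 : R) <= y] `&`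
      (fun v : 'rV[R]_n.+1 => peval al (v ord0) (t, 0%N)) @^-1` [set y | y <= f t]))%classic.
    apply: closed_bigI => t _; apply: closedI; apply: preimage_closed.
    - by move=> v _; apply: peval_cont.
    - exact: closed_ge.
    - by move=> v _; apply: peval_cont.
    - exact: closed_le.
  apply/seteqP; split=> v /= hv t ht; first by have /andP[] := hv t ht.
  by have [p0 p1] := hv t ht; apply/andP.
have [B hB] := in_band_coef_bounded f hal b0.
have Kco : compact K.
  apply: (subclosed_compact Kcl) (rV_compact (fun i => @segment_compact R (- B) B)) _.
  by move=> v /= hv i; rewrite in_itv/= -ler_norml hB.
have [||v] := @EVT_max_rV R n.+1 (fun v => v ord0 ord_max) K _ Kco.
- exists 0 => t ht; rewrite /peval big1 ?lexx ?f0// => i _.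
  by rewrite mxE mul0r.
- by apply: continuous_subspaceT; apply: coord_continuous.
rewrite inE => hv vmax; exists (v ord0) => // a ha.
have := vmax (\row_i a i); rewrite mxE inE; apply => t ht.
have := ha t ht; rewrite (_ : peval _ _ _ = peval al a (t, 0%N))//.
by apply: eq_bigr => i _; rewrite mxE.
Qed.

(** * Separating two closed sets that do not alternate *)

(** [alternation k P M c]: there are k points, going down from c, taken alternately
    from P and from M, the largest one in P. Weak inequalities are enough, as
    the two sets are disjoint where this is used. *)
Fixpoint alternation (R : realType) (k : nat) (P M : set R) (c : R) : Prop :=
  if k is k'.+1 then exists z, [/\ z <= c, P z & alternation k' M P z] else True.

Lemma alternation_seq (R : realType) k (P M : set R) (c : R) :
  alternation k P M c ->
  exists z : nat -> R, [/\ (forall i, (i < k)%N -> if odd i then M (z i) else P (z i)),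
    (forall i, (i.+1 < k)%N -> z i.+1 <= z i) & (0 < k)%N -> z 0%N <= c].
Proof.
elim: k P M c => [|k IHk] P M c /=; first by exists (fun=> c).
move=> [x [xc Px /IHk[z [zPM zi z0]]]].
exists (fun i => if i is j.+1 then z j else x); split=> //.
- by case=> [//|i] ik /=; have := zPM i ik; case: (odd i).
- by case=> [|i] ik; [exact: z0 | exact: zi].
Qed.

Lemma closed_max (R : realType) (P : set R) (c : R) :
  closed P -> ~ P c -> (exists2 t, P t & t <= c) ->
  exists2 s, P s /\ s < c & forall t, P t -> t <= c -> t <= s.
Proof.
move=> Pcl nPc [t0 Pt0 t0c]; pose S := (P `&` [set t | t <= c])%classic.
have S0 : (S !=set0)%classic by exists t0.
have Sub : has_ubound S by exists c => t [].
have Scl : closed S by apply: closedI => //; apply: closed_le.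
have [Ps sc] := Scl _ (closure_sup S0 Sub).
exists (sup S) => [|t Pt tc]; last by apply: ub_le_sup.
split=> //; rewrite lt_neqAle sc andbT; apply/eqP => sE.
by apply: nPc; rewrite -sE.
Qed.

Lemma closed_gap (R : realType) (M : set R) (s c : R) :
  closed M -> ~ M s -> s < c ->
  exists2 e, s < e < c & forall t, M t -> s < t -> e < t.
Proof.
move=> Mcl nMs sc.
have : nbhs s (~` M)%classic.
  by apply: open_nbhs_nbhs; split=> //; apply: closed_openC.
move=> /nbhs_ballP[d /= d0 dM].
(* Half the radius of a ball around s avoiding M, cut to stay below c. *)
exists (Num.min (s + d / 2) ((s + c) / 2)).
  by rewrite lt_min gt_min; apply/andP; split; [apply/andP; split|apply/orP; right]; lra.
move=> t Mt st; rewrite ltNge; apply/negP; rewrite le_min => /andP[td _].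
by apply: (dM t) => //; rewrite /ball /= distrC gtr0_norm; lra.
Qed.

(** Cut just above the largest point s of P below c: no point of M may
    then lie in the gap, and below s there is no alternation of one point less
    starting in M, so the induction hypothesis with P and M exchanged applies.
    The index i counts the separators below t, so that P and M are found in the
    gaps with odd and even distance to the top one. *)
Lemma separators (R : realType) k (P M : set R) (c : R) :
  closed P -> closed M -> (forall t, P t -> ~ M t) ->
  (forall t, P t -> 0 <= t) -> (forall t, M t -> 0 <= t) ->
  ~ P c -> ~ alternation k.+1 P M c ->
  exists (j : nat) (z : nat -> R), [/\ (j <= k)%N,
    (forall i, (i < j)%N -> 0 < z i < c),
    (forall i, (i.+1 < j)%N -> z i < z i.+1) &
    forall t, t <= c -> P t \/ M t -> exists i, [/\ (i <= j)%N,
      (forall l, (l < i)%N -> z l < t),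
      (forall l, (i <= l < j)%N -> t < z l) &
      if odd (i + j) then P t else M t]].
Proof.
elim: k P M c => [|k IHk] P M c Pcl Mcl PM P0 M0 nPc nalt.
  exists 0%N, (fun=> 0); split=> // t tc [Pt|Mt].
    by case: nalt; exists t.
  by exists 0%N; split=> // l; rewrite ltn0 andbF.
have [Pne|Pe] := pselect (exists2 t, P t & t <= c); last first.
  exists 0%N, (fun=> 0); split=> // t tc [Pt|Mt].
    by case: Pe; exists t.
  by exists 0%N; split=> // l; rewrite ltn0 andbF.
have [s [Ps sc] smax] := closed_max Pcl nPc Pne.
have [e /andP[se ec] eM] := closed_gap Mcl (PM _ Ps) sc.
have [] := IHk M P s => //.
- by move=> t Mt Pt; apply: (PM t).
- exact: PM.
- by move=> salt; apply: nalt; exists s; split=> //; apply: ltW.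
move=> j [z [jk z0 zi zpos]].
exists j.+1, (fun i => if (i < j)%N then z i else e); split=> //.
- move=> i; rewrite ltnS leq_eqVlt => /predU1P[->|ij].
    by rewrite ltnn ec (le_lt_trans (P0 _ Ps)).
  by rewrite ij; have /andP[-> zs] := z0 _ ij; apply: lt_trans sc.
- move=> i; rewrite ltnS => ij; rewrite ij.
  case: ifP => [|_]; first exact: zi.
  by have /andP[_ zs] := z0 _ ij; apply: lt_trans se.
move=> t tc PMt; have [ts|st] := leP t s.
  have [|i [ij zl zr PMi]] := zpos t ts; first by case: PMt; [right|left].
  exists i; split.
  - exact: leqW.
  - by move=> l li; rewrite (leq_trans li ij); apply: zl.
  - move=> l /andP[il]; rewrite ltnS leq_eqVlt => /predU1P[->|lj].
      by rewrite ltnn; apply: le_lt_trans se.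
    by rewrite lj; apply: zr; rewrite il.
  - by rewrite addnS /=; case: odd PMi.
exists j.+1; split=> //.
- move=> l lj; case: PMt => [Pt|Mt].
    by have := smax t Pt tc; rewrite leNgt st.
  case: ifP => [lj'|_]; last exact: eM.
  by have /andP[_ zs] := z0 _ lj'; apply: lt_trans st.
- by move=> l /andP[jl]; rewrite ltnNge jl.
rewrite addnn odd_double; case: PMt => // Pt.
by have := smax t Pt tc; rewrite leNgt st.
Qed.

(** * Sign patterns prescribed at given points *)

Definition insert_row (R : realType) (r : nat -> R * nat) (k : nat) (t : R) (j : nat) :=
  if (j < k)%N then r j else if j == k then (t, 0%N) else r j.-1.

Lemma insert_row_bump (R : realType) (r : nat -> R * nat) k t :
  insert_row r k t \o bump k = r.
Proof.
apply/funext => j; rewrite /insert_row /= /bump.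
have [kj|jk] := leqP k j; last by rewrite add0n jk.
by rewrite add1n ltnNge (leqW kj) /= gtn_eqF.
Qed.

Lemma insert_row_sorted (R : realType) (r : nat -> R * nat) n k t :
  sorted_rows r n -> (k <= n)%N -> 0 <= t ->
  (forall l, (l < k)%N -> (r l).1 < t) ->
  ((k < n)%N -> t < (r k).1 /\ (r k).2 = 0%N) ->
  sorted_rows (insert_row r k t) n.+1.
Proof.
move=> [r0 d0 rn] kn t0 rl rr; rewrite /insert_row; split.
- by case: ifP => // _; case: ifP.
- by case: ifP => // _; case: ifP.
move=> j jn; have [jk|kj|jk] := ltngtP j k.
- have [jk'|//|jk'] := ltngtP j.+1 k.
  + by apply: rn; apply: leq_trans jk' kn.
  + by lia.
  + by left; split=> //; apply: rl.
- rewrite ltnNge (ltnW (leqW kj)) /= gtn_eqF ?leqW//.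
  by case: j kj jn => [//|j] kj jn; apply: rn.
- rewrite jk ltnNge leqnSn /= gtn_eqF//.
  by left; have [] := rr; first by rewrite -jk.
Qed.

Lemma insert_row_cramer (R : realType) n (al a : 'I_n.+1 -> R) (r : nat -> R * nat) k t :
  (k <= n)%N -> (forall j, (j < n)%N -> peval al a (r j) = 0) ->
  \det (rowmx al (insert_row r k t)) * a ord_max =
  \det (rowmx (al \o lift ord_max) r) * ((-1) ^+ (k + n) * peval al a (t, 0%N)).
Proof.
move=> kn rz; have kN : (k < n.+1)%N by rewrite ltnS.
rewrite (@rowmx_cramer_last _ _ _ _ _ (Ordinal kN)) => [|j]; last first.
  rewrite neq_ltn /= /insert_row => /orP[jk|kj].
    by rewrite jk; apply: rz; apply: leq_trans kn.
  rewrite ltnNge (ltnW kj) /= gtn_eqF//; apply: rz.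
  by case: j kj => -[|j] //=.
rewrite /= insert_row_bump [in LHS]/insert_row ltnn eqxx.
by rewrite [_ ^+ _ * \det _]mulrC mulrA.
Qed.

(** If p vanishes on the n rows r, the value of p at a further point in position k
    has the sign (-1)^(k+n) relative to the leading coefficient: both determinants
    in [insert_row_cramer] are positive. *)
Lemma insert_row_sign (R : realType) n (al a : 'I_n.+1 -> R) (r : nat -> R * nat) k t :
  exponents al -> sorted_rows r n -> (forall j, (j < n)%N -> peval al a (r j) = 0) ->
  (k <= n)%N -> 0 <= t -> (forall l, (l < k)%N -> (r l).1 < t) ->
  ((k < n)%N -> t < (r k).1 /\ (r k).2 = 0%N) ->
  exists2 c, 0 < c & a ord_max = c * ((-1) ^+ (k + n) * peval al a (t, 0%N)).
Proof.
move=> hal hr rz kn t0 rl rr; have D0 := det_rowmx_widen_gt0 hal hr.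
have E0 := det_rowmx_gt0 hal (insert_row_sorted hr kn t0 rl rr).
exists (\det (rowmx (al \o lift ord_max) r) / \det (rowmx al (insert_row r k t))).
  by rewrite divr_gt0.
apply: (mulfI (lt0r_neq0 E0)); rewrite insert_row_cramer// [RHS]mulrA [X in _ = X * _]mulrCA.
by rewrite mulfV ?gt_eqF// mulr1.
Qed.

(** With j = n the function is the determinant with the variable point as last
    row; smaller j use only the first j+1 exponents, and then the leading
    coefficient is 0. *)
Lemma separating_poly (R : realType) n (al : 'I_n.+1 -> R) (j : nat) (z : nat -> R) :
  exponents al -> (j <= n)%N -> (forall i, (i < j)%N -> 0 < z i) ->
  (forall i, (i.+1 < j)%N -> z i < z i.+1) ->
  exists2 h, 0 <= h ord_max & forall t i, 0 <= t -> (i <= j)%N ->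
    (forall l, (l < i)%N -> z l < t) -> (forall l, (i <= l < j)%N -> t < z l) ->
    0 < (-1) ^+ (i + j) * peval al h (t, 0%N).
Proof.
move=> + + z0 zi.
elim: n al => [|n IHn] al hal.
  rewrite leqn0 => /eqP j0; subst j; exists (fun=> 1); first exact: ler01.
  move=> t i _; rewrite leqn0 => /eqP -> _ _; rewrite mul1r /peval big_ord1.
  by case: hal => al0 _; rewrite al0 /monrow /= powRr0 mul1r ltr01.
rewrite leq_eqVlt => /predU1P[jn|]; last first.
  move=> /(IHn _ (exponents_widen hal))[h h0 hpos].
  exists (fun i => if unlift ord_max i is Some i' then h i' else 0).
    by rewrite unlift_none.
  move=> t i t0 ij zl zr; have := hpos t i t0 ij zl zr.
  rewrite /peval [in X in _ -> X]big_ord_recr /= unlift_none mul0r addr0.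
  rewrite (_ : \sum_(_ < _) _ = \sum_(i0 < n.+1)
    (if unlift ord_max (widen_ord (leqnSn n.+1) i0) is Some i' then h i' else 0) *
     monrow (al (widen_ord (leqnSn n.+1) i0)) (t, 0%N))//.
  apply: eq_bigr => k _; have -> : widen_ord (leqnSn n.+1) k = lift ord_max k.
    by apply: val_inj; rewrite /= /bump leqNgt ltn_ord.
  by rewrite liftK.
have hz : sorted_rows (simple_rows z) n.+1.
  apply: simple_rows_sorted => [|k]; first by apply/ltW/z0; rewrite jn.
  by rewrite -jn; apply: zi.
have D0 := det_rowmx_widen_gt0 hal hz.
exists (cofactor (rowmx al (simple_rows z)) ord_max) => [|t i t0 ij zl zr].
  by rewrite cofactor_rowmx_max ltW.
have [|||||||c c0 hE] := @insert_row_sign R n.+1 al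
    (cofactor (rowmx al (simple_rows z)) ord_max) (simple_rows z) i t => //.
- by move=> k; apply: peval_cofactor_eq0.
- by rewrite -jn.
- by move=> i_n; split=> //; apply: zr; rewrite leqnn jn.
by rewrite jn -(pmulr_rgt0 _ c0) -hE cofactor_rowmx_max.
Qed.

(** Where u is small, h is negative: max(u, -h) has a positive minimum m, so
    u >= m or -h >= m at each point, and d h stays below m / 2 for small d. *)
Lemma perturb_gt0 (R : realType) (u h : R -> R) (b : R) :
  0 <= b -> continuous u -> continuous h ->
  (forall t, 0 <= t <= b -> 0 <= u t) ->
  (forall t, 0 <= t <= b -> u t = 0 -> h t < 0) ->
  exists2 d0, 0 < d0 & forall d, 0 < d <= d0 ->
    exists2 m, 0 < m & forall t, 0 <= t <= b -> m <= u t - d * h t.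
Proof.
move=> b0 uc hc u0 uh.
have [c cb cmin] : exists2 c, c \in `[0, b]%R &
    forall t, t \in `[0, b]%R -> Num.max (u c) (- h c) <= Num.max (u t) (- h t).
  apply: EVT_min => //; apply: continuous_subspaceT.
  apply: (max_fun_continuous uc) => t; apply: continuousN; exact: hc.
have [e eb emax] : exists2 e, e \in `[0, b]%R & forall t, t \in `[0, b]%R -> h t <= h e.
  by apply: EVT_max => //; apply: continuous_subspaceT.
set m := Num.max (u c) (- h c) in cmin.
have m0 : 0 < m.
  rewrite in_itv/= in cb; rewrite lt_max oppr_gt0.
  by have := u0 _ cb; rewrite le_eqVlt => /predU1P[/esym/(uh _ cb) ->|->]; rewrite ?orbT.
pose H := `|h e| + 1; have H0 : 0 < H by rewrite ltr_wpDl.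
exists (m / (2 * H)); first by rewrite divr_gt0// mulr_gt0.
move=> d /andP[d0 dle]; exists (Num.min (m / 2) (d * m)).
  by rewrite lt_min divr_gt0//= mulr_gt0.
move=> t tb; have tb' : t \in `[0, b]%R by rewrite in_itv.
have hH : h t <= H by have := emax t tb'; have := ler_norm (h e); rewrite /H; lra.
have dH : d * H <= m / 2.
  by move: dle; rewrite ler_pdivlMr ?mulr_gt0// => dle; lra.
have := cmin t tb'; rewrite le_max ge_min => /orP[mu|mh]; apply/orP.
  left; have : d * h t <= d * H by rewrite ler_pM2l.
  by lra.
right; have : d * m <= d * - h t by rewrite ler_pM2l.
by have := u0 t tb; rewrite mulrN; lra.
Qed.

(** * An extremal function oscillates between 0 and f *)

Lemma peval_closed (R : realType) n (al a : 'I_n.+1 -> R) (b : R) :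
  exponents al ->
  closed [set t | 0 <= t <= b /\ peval al a (t, 0%N) = 0]%classic.
Proof.
move=> hal; rewrite (_ : [set t | _]%classic =
  (`[0, b] `&` (fun t : R => peval al a (Num.max t 0, 0%N)) @^-1` [set 0])%classic).
  apply: closedI; first exact: interval_closed.
  apply: preimage_closed; last exact: closed_eq.
  by move=> t _; apply: peval_max0_continuous.
by apply/seteqP; split=> t /= []; rewrite in_itv/= => tb; case/andP: (tb) => t0 _;
  rewrite ?(max_l t0).
Qed.

Lemma peval_lin (R : realType) n (al a a' : 'I_n -> R) (c c' : R) zd :
  peval al (fun i => c * a i + c' * a' i) zd = c * peval al a zd + c' * peval al a' zd.
Proof.
rewrite /peval !mulr_sumr -big_split; apply: eq_bigr => i _ /=.
by rewrite mulrDl !mulrA.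
Qed.

(** Otherwise a function h separating the contact sets exists, and moving p in
    its direction detaches it from both 0 and f by a positive margin, which is
    spent on a small positive multiple of the leading power. *)
Lemma extremal_alternates (R : realType) n (al af p : 'I_n.+1 -> R) (b : R) :
  exponents al -> 0 < b ->
  let f := fun t => peval al af (t, 0%N) in
  (forall t, 0 <= t <= b -> 0 < f t) ->
  in_band al f b p ->
  (forall a, in_band al f b a -> a ord_max <= p ord_max) ->
  alternation n.+1 [set t | 0 <= t <= b /\ peval al p (t, 0%N) = f t]%classic
    [set t | 0 <= t <= b /\ peval al p (t, 0%N) = 0]%classic (b + 1).
Proof.
move=> hal b0 f f0 pf pmax; apply: contrapT => nalt.
set P := [set t | 0 <= t <= b /\ _ = f t]%classic in nalt.
set M := [set t | _]%classic in nalt.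
pose u i := af i - p i.
have PE : P = [set t | 0 <= t <= b /\ peval al u (t, 0%N) = 0]%classic.
  apply/seteqP; split=> t /= [tb]; rewrite pevalB => pt.
    by rewrite pt subrr.
  by split=> //; apply/eqP; rewrite eq_sym -subr_eq0 pt.
(* The bound b + 1 only serves to lie above both sets, so that P cannot
   contain it. *)
have [|||t [/andP[]]|t [/andP[]]|[/andP[_]]|//|j [z [jn z0 zi zpos]]] :=
    @separators R n P M (b + 1) => //.
- by rewrite PE; apply: peval_closed.
- exact: peval_closed.
- by move=> t [tb pt] [_]; rewrite pt; have := f0 t tb; lra.
- by lra.
have z_gt0 i : (i < j)%N -> 0 < z i by move=> /z0/andP[].
have [h h0 hpos] := separating_poly hal jn z_gt0 zi.
have hPM t : 0 <= t <= b -> P t \/ M t ->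
    if (peval al h (t, 0%N) < 0) then P t else 0 < peval al h (t, 0%N) /\ M t.
  move=> /andP[t0 tb] PMt.
  have [|i [ij zl zr PMi]] := zpos t _ PMt; first by lra.
  have := hpos t i t0 ij zl zr; rewrite -signr_odd; case: odd PMi => PMi.
    by rewrite expr1 mulN1r oppr_gt0 => ->.
  by rewrite expr0 mul1r => h1; rewrite ltNge ltW.
have fP t : 0 <= t <= b -> P t -> ~ M t.
  by move=> tb [_ pt] [_]; rewrite pt; have := f0 t tb; lra.
pose ce a t : R := peval al a (Num.max t 0, 0%N).
have ceE a t : 0 <= t <= b -> ce a t = peval al a (t, 0%N).
  by move=> /andP[t0 _]; rewrite /ce max_l.
have [d1 d1_gt0 hd1] : exists2 d0, 0 < d0 & forall d, 0 < d <= d0 ->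
    exists2 m, 0 < m & forall t, 0 <= t <= b -> m <= ce u t - d * ce h t.
  apply: perturb_gt0; rewrite ?ltW//; try exact: peval_max0_continuous.
    by move=> t tb; rewrite ceE// pevalB subr_ge0; have /andP[] := pf t tb.
  move=> t tb; rewrite !ceE// => ut; have Pt : P t by rewrite PE.
  have := hPM t tb (or_introl Pt); case: ifP => // _ [_ Mt].
  by have := fP t tb Pt.
have [d2 d2_gt0 hd2] : exists2 d0, 0 < d0 & forall d, 0 < d <= d0 ->
    exists2 m, 0 < m & forall t, 0 <= t <= b -> m <= ce p t - d * - ce h t.
  apply: perturb_gt0; rewrite ?ltW//; try exact: peval_max0_continuous.
  - by move=> t; apply: continuousN; apply: peval_max0_continuous.
  - by move=> t tb; rewrite ceE//; have /andP[] := pf t tb.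
  move=> t tb; rewrite !ceE// oppr_lt0 => pt; have Mt : M t by [].
  have := hPM t tb (or_intror Mt); case: ifP => [_ Pt|_ []//].
  by have := fP t tb Pt.
pose d := Num.min d1 d2.
have d0 : 0 < d by rewrite lt_min d1_gt0.
have [|m1 m1_gt0 hm1] := hd1 d; first by rewrite d0 ge_min lexx.
have [|m2 m2_gt0 hm2] := hd2 d; first by rewrite d0 ge_min lexx orbT.
(* e t^(al_n) stays below the margin m1 on [0, b]. *)
pose e := m1 / (b `^ al ord_max + 1).
have B0 : 0 < b `^ al ord_max + 1 by rewrite ltr_wpDl ?powR_ge0.
have e0 : 0 < e by rewrite divr_gt0.
pose q i := 1 * p i + d * h i.
pose q' i := 1 * q i + e * (i == ord_max)%:R.
have q'E t : peval al q' (t, 0%N) =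
    peval al p (t, 0%N) + d * peval al h (t, 0%N) + e * t `^ al ord_max.
  rewrite !peval_lin !mul1r; congr (_ + _ * _).
  rewrite /peval (bigD1 ord_max)//= big1 ?addr0 ?eqxx ?mul1r// => i im.
  by rewrite (negbTE im) mul0r.
have : q' ord_max <= p ord_max.
  apply: pmax => t tb; rewrite q'E; case/andP: (tb) => t0 tleb.
  have tbe : t `^ al ord_max <= b `^ al ord_max.
    by apply: ge0_ler_powR => //; rewrite ?nnegrE ?(ltW b0)// exponents_ge0.
  have te0 := powR_ge0 t (al ord_max).
  have ete0 : 0 <= e * t `^ al ord_max by rewrite mulr_ge0// ltW.
  have ete1 : e * t `^ al ord_max <= m1.
    have -> : m1 = e * (b `^ al ord_max + 1) by rewrite /e divfK// gt_eqF.
    by rewrite ler_pM2l//; lra.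
  have := hm1 t tb; have := hm2 t tb; rewrite !ceE// pevalB /f; lra.
have : 0 <= d * h ord_max by rewrite mulr_ge0// ltW.
by rewrite /q' /q eqxx mulr1; lra.
Qed.

(** * Nodes of the extremal function *)

(** The rows carrying the zeros of a nonnegative function that vanishes at the w_k
    with k of parity e: w_e, w_e, w_(e+2), w_(e+2), ..., each interior node
    doubled, but w_0 alone when e is even. Row k sits at node k or k+1, whichever
    has parity e, and is the derivative row exactly when that is k. *)
Definition node_rows (R : realType) (e : bool) (w : nat -> R) (k : nat) : R * nat :=
  (w (k + (odd k (+) e))%N, (0 < k)%N && (odd k == e) : nat).

Lemma node_rows_flag (R : realType) (e : bool) (w : nat -> R) (k : nat) :
  (0 < k)%N -> odd k = e -> node_rows e w k = (w k, 1%N).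
Proof. by move=> k0 ke; rewrite /node_rows k0 ke eqxx addbb addn0. Qed.

Lemma node_rows_value (R : realType) (e : bool) (w : nat -> R) (k : nat) :
  (k == 0%N) || (odd k != e) -> node_rows e w k = (w (k + (odd k (+) e))%N, 0%N).
Proof. by rewrite /node_rows; case: k => [//|k] /= /negbTE ->. Qed.

Lemma node_index_lt n l : (l < n)%N -> (l + (odd l (+) ~~ odd n) < n)%N.
Proof.
rewrite leq_eqVlt => /predU1P[<-|ln]; first by rewrite /= negbK addbb addn0.
by case: (_ (+) _); lia.
Qed.

(** When n has parity e, row n sits at the last node as well, so that n+1 rows are
    available. *)
Lemma node_rows_sorted (R : realType) (e : bool) (w : nat -> R) n N :
  0 <= w 0%N -> (forall k, (k < n)%N -> w k < w k.+1) ->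
  (0 < N)%N -> (N <= n)%N || (N == n.+1) && (odd n == e) ->
  sorted_rows (node_rows e w) N.
Proof.
move=> w0 wi N0 Nn; have wlt := increasing_lt wi; split=> [||k kN].
- rewrite /= add0n; case: e Nn => //= Nn; apply/ltW/(le_lt_trans w0)/wi.
  by case: n Nn {wi wlt} => [|n]//; rewrite andbF orbF; case: N N0.
- by [].
have [ke|ke] := eqVneq (odd k.+1) e.
  right; rewrite (node_rows_flag w (ltn0Sn k) ke) node_rows_value; last first.
    by rewrite -ke /=; case: odd; rewrite orbT.
  rewrite -ke /= addbN addbb addn1; split=> //.
  by apply: le_lt_trans w0 _; apply: wlt => /=; lia.
left; have ke' : odd k = e by move: ke; rewrite /=; case: odd; case: (e).
rewrite [node_rows e w k.+1]node_rows_value ?ke ?orbT//= -ke' addbb addn0 addNb addbb addn1.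
split=> //; apply: wlt; rewrite ltnW//=.
move: Nn kN => /orP[|/andP[/eqP -> /eqP ne]]; first by lia.
rewrite ltnS leq_eqVlt => /predU1P[kn|//].
by move: ke; rewrite kn ne eqxx.
Qed.

(** An interior zero of a nonnegative function is a minimum. *)
Lemma nonneg_zero_row (R : realType) n (al a : 'I_n.+1 -> R) (b z : R) :
  (forall t, 0 <= t <= b -> 0 <= peval al a (t, 0%N)) -> 0 < z < b ->
  peval al a (z, 0%N) = 0 -> peval al a (z, 1%N) = 0.
Proof.
move=> a0 zb pz; case/andP: (zb) => z0 z_b.
have dz := peval_is_derive al a z0.
have : is_derive z 1 (fun t : R => peval al a (t, 0%N)) 0.
  apply: (@derive1_at_min _ _ 0 b) => //.
  - by rewrite ltW// (lt_trans z0).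
  - move=> t; rewrite in_itv/= => /andP[t0 _].
    by have := peval_is_derive al a t0; case.
  - move=> t; rewrite in_itv/= => /andP[t0 tb]; rewrite pz.
    by apply: a0; rewrite !ltW.
by move=> dz0; rewrite -(@derive_val _ _ _ _ _ _ _ dz) (@derive_val _ _ _ _ _ _ _ dz0).
Qed.

Lemma node_rows_zero (R : realType) n (al g : 'I_n.+1 -> R) (b : R) (e : bool)
    (w : nat -> R) N M :
  0 <= w 0%N -> (forall k, (k < M)%N -> w k < w k.+1) ->
  (forall t, 0 <= t <= b -> 0 <= peval al g (t, 0%N)) ->
  (forall k, (k <= M)%N -> odd k = e -> peval al g (w k, 0%N) = 0) ->
  (N <= M)%N || (N == M.+1) && (odd M == e) ->
  (forall k, (0 < k < N)%N -> odd k = e -> w k < b) ->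
  forall k, (k < N)%N -> peval al g (node_rows e w k) = 0.
Proof.
move=> w0 wi g0 gz NM wb k kN; have wlt := increasing_lt wi.
have kM : (k <= M)%N by move: NM kN => /orP[|/andP[/eqP -> _]]; lia.
have [/andP[k0 /eqP ke]|nke] := boolP ((0 < k)%N && (odd k == e)).
  rewrite node_rows_flag//; apply: (@nonneg_zero_row _ _ _ _ b) => //; last exact: gz.
  by rewrite wb ?k0// andbT; apply: le_lt_trans w0 _; apply: wlt; rewrite k0.
have kz : (k == 0%N) || (odd k != e) by move: nke; rewrite negb_and lt0n negbK.
rewrite node_rows_value//.
have [ke|ke] := eqVneq (odd k) e; first by rewrite ke addbb addn0; apply: gz.
have ke' : odd k.+1 = e by move: ke => /=; case: odd; case: (e).
have -> : odd k (+) e by move: ke; case: odd; case: (e).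
rewrite addn1; apply: gz => //.
move: NM kN => /orP[|/andP[/eqP -> /eqP Me]]; first by lia.
rewrite ltnS leq_eqVlt => /predU1P[kM'|//].
by rewrite kM' Me eqxx in ke.
Qed.

(** If w_n were below b, all the first n+1 rows of [node_rows] would vanish on g,
    which only the zero function allows. *)
Lemma top_node (R : realType) n (al g : 'I_n.+1 -> R) (b : R) (w : nat -> R) :
  exponents al -> 0 <= w 0%N -> (forall k, (k < n)%N -> w k < w k.+1) -> w n <= b ->
  (forall t, 0 <= t <= b -> 0 <= peval al g (t, 0%N)) ->
  (forall k, (k <= n)%N -> odd k = odd n -> peval al g (w k, 0%N) = 0) ->
  (exists i, g i != 0) -> w n = b.
Proof.
move=> hal w0 wi wn g0 gz [i gi]; apply/eqP; rewrite eq_le wn /= leNgt.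
apply: contraNN gi => wnb; apply/eqP; have wlt := increasing_lt wi.
have hN : (n.+1 <= n)%N || (n.+1 == n.+1) && (odd n == odd n) by rewrite !eqxx orbT.
apply: (peval_rows_eq0 hal (node_rows_sorted w0 wi (ltn0Sn n) hN)).
apply: (node_rows_zero w0 wi g0 gz hN) => k /andP[_]; rewrite ltnS leq_eqVlt.
move=> /predU1P[->//|kn] _; apply: lt_trans wnb; apply: wlt.
by rewrite kn /=.
Qed.

(** If w_0 were positive it would be a double zero. Putting 0 in front as a dummy
    node makes the even nodes odd, so that the doubled rows, n+1 of which
    vanish on g, are again given by [node_rows]. *)
Lemma bottom_node (R : realType) n (al g : 'I_n.+1 -> R) (b : R) (w : nat -> R) :
  exponents al -> 0 <= w 0%N -> (forall k, (k < n)%N -> w k < w k.+1) -> w n <= b ->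
  (forall t, 0 <= t <= b -> 0 <= peval al g (t, 0%N)) ->
  (forall k, (k <= n)%N -> ~~ odd k -> peval al g (w k, 0%N) = 0) ->
  (exists i, g i != 0) -> w 0%N = 0.
Proof.
move=> hal w0 wi wn g0 gz [i gi]; apply/eqP; rewrite eq_le w0 andbT leNgt.
apply: contraNN gi => w0_gt0; apply/eqP; have wlt := increasing_lt wi.
pose v k := if k is k'.+1 then w k' else 0.
have vi k : (k < n.+1)%N -> v k < v k.+1 by case: k => [//|k] /= kn; apply: wi.
have hN : (n.+1 <= n.+1)%N || (n.+1 == n.+2) && (odd n.+1 == true) by rewrite leqnn.
have v0 : 0 <= v 0%N by [].
apply: (peval_rows_eq0 hal (node_rows_sorted v0 vi (ltn0Sn n) hN)).
have vz k : (k <= n.+1)%N -> odd k = true -> peval al g (v k, 0%N) = 0.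
  by case: k => [//|k] /= kn kodd; apply: gz.
apply: (node_rows_zero v0 vi g0 vz hN) => -[//|k] /= kn _.
apply: lt_le_trans (wi k kn) _; move: (kn : (k.+1 <= n)%N).
rewrite leq_eqVlt => /predU1P[->//|kn1].
by apply: le_trans (ltW (wlt _ _ _)) wn; rewrite kn1 /=.
Qed.

(** g touches 0 and the function of coefficients a alternately at n+1 points, the
    latter at the last one. *)
Definition alternating_contact (R : realType) n (al a g : 'I_n.+1 -> R) (b : R) :=
  exists w : nat -> R, [/\ 0 <= w 0%N, w n <= b, forall k, (k < n)%N -> w k < w k.+1 &
    forall k, (k <= n)%N -> peval al g (w k, 0%N) =
      if odd (k + n) then 0 else peval al a (w k, 0%N)].

Lemma snake_nodes (R : realType) n (al af p : 'I_n.+1 -> R) (b : R) :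
  exponents al -> 0 < b ->
  let f := fun t => peval al af (t, 0%N) in
  (forall t, 0 <= t <= b -> 0 < f t) ->
  in_band al f b p ->
  (forall a, in_band al f b a -> a ord_max <= p ord_max) ->
  alternating_contact al af p b.
Proof.
move=> hal b0 f f0 pf pmax.
have [z [zPM zi _]] := alternation_seq (extremal_alternates hal b0 f0 pf pmax).
have wPM k : (k <= n)%N -> 0 <= z (n - k)%N <= b /\
    peval al p (z (n - k)%N, 0%N) = if odd (k + n) then 0 else f (z (n - k)%N).
  move=> kn; have := zPM (n - k)%N; rewrite ltnS leq_subr => /(_ isT).
  by rewrite oddB// oddD addbC; case: (_ (+) _) => -[].
(* The sequence z is decreasing. *)
exists (fun k => z (n - k)%N); split=> [|| k kn|k /wPM[]//].
- by have [/andP[]] := wPM _ (leq0n n).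
- by have [/andP[]] := wPM _ (leqnn n).
have := zi (n - k.+1)%N; rewrite subnSK// ltnS leq_subr => /(_ isT).
rewrite le_eqVlt => /predU1P[zE|//].
have [zb pk] := wPM _ (ltnW kn); have [_ pk1] := wPM _ kn.
have := f0 _ zb; move: pk1; rewrite -zE pk addSn /=.
by case: odd => /= E; [rewrite -E | rewrite E]; rewrite !ltxx.
Qed.

(** The zeros of p lie at the nodes of parity opposite to n, those of u at the nodes
    of the parity of n; the sign of the leading coefficient of p comes from
    its value at b, that of u from its value at the last node but one. *)
Lemma snake_exists (R : realType) n (al af : 'I_n.+1 -> R) (b : R) :
  exponents al -> 0 < b -> (0 < n)%N ->
  let f := fun t => peval al af (t, 0%N) in
  (forall t, 0 <= t <= b -> 0 < f t) ->
  exists p u w, let er := node_rows (odd n) w in let lr := node_rows (~~ odd n) w in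
    [/\ forall i, af i = p i + u i, in_band al f b p,
        [/\ w 0%N = 0, w n = b & forall k, (k < n)%N -> w k < w k.+1],
        [/\ sorted_rows lr n, (forall k, (k < n)%N -> peval al p (lr k) = 0) & 0 < p ord_max] &
        [/\ sorted_rows er n, (forall k, (k < n)%N -> peval al u (er k) = 0) & u ord_max < 0]].
Proof.
move=> hal b0 n0 f f0.
have [p pf pmax] := in_band_max_coef hal b0 (fun t tb => ltW (f0 t tb)).
have [w [w0 wn wi pw]] := snake_nodes hal b0 f0 pf pmax.
pose u i := af i - p i.
have wlt := increasing_lt wi.
have p0 t : 0 <= t <= b -> 0 <= peval al p (t, 0%N) by move=> /pf/andP[].
have u0 t : 0 <= t <= b -> 0 <= peval al u (t, 0%N).
  by move=> /pf/andP[_]; rewrite pevalB subr_ge0.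
have wb k : (k <= n)%N -> 0 <= w k <= b := increasing_within w0 wn wi.
have pz k : (k <= n)%N -> odd k = ~~ odd n -> peval al p (w k, 0%N) = 0.
  by move=> kn ko; rewrite pw// oddD ko addNb addbb.
have uz k : (k <= n)%N -> odd k = odd n -> peval al u (w k, 0%N) = 0.
  by move=> kn ko; rewrite pevalB pw// oddD ko addbb subrr.
have upos : 0 < peval al u (w n.-1, 0%N).
  rewrite pevalB pw ?leq_pred// (_ : odd _ = true) ?subr0; last first.
    by rewrite -[X in odd (_ + X)%N](prednK n0) addnS addnn /= odd_double.
  by apply/f0/wb/leq_pred.
have ppos : 0 < peval al p (w n, 0%N).
  by rewrite pw// oddD addbb; apply/f0/wb.
have nz g t : 0 < peval al g t -> exists i, g i != 0.
  move=> gt; apply: contrapT => /forallNP g0; move: gt.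
  by rewrite /peval big1 ?ltxx// => i _; have /negP/negPn/eqP -> := g0 i; rewrite mul0r.
have wnE : w n = b by apply: (top_node hal w0 wi wn u0) => //; apply: nz upos.
have w0E : w 0%N = 0.
  have [no|ne] := boolP (odd n).
    apply: (bottom_node hal w0 wi wn p0); last exact: nz ppos.
    by move=> k kn /negbTE ko; apply: pz; rewrite ?ko ?no.
  apply: (bottom_node hal w0 wi wn u0); last exact: nz upos.
  by move=> k kn /negbTE ko; apply: uz; rewrite ?ko ?(negbTE ne).
have hN e : (n <= n)%N || (n == n.+1) && (odd n == e) by rewrite leqnn.
have wlb e k : (0 < k < n)%N -> odd k = e -> w k < b.
  by move=> /andP[_ kn] _; rewrite -wnE; apply: wlt; rewrite kn /=.
have lsort := node_rows_sorted w0 wi n0 (hN (~~ odd n)).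
have esort := node_rows_sorted w0 wi n0 (hN (odd n)).
have lz := node_rows_zero w0 wi p0 pz (hN _) (wlb _).
have ez := node_rows_zero w0 wi u0 uz (hN _) (wlb _).
exists p, u, w; split=> //; first by move=> i; rewrite /u addrC subrK.
- split=> //; have [l ln||c c0 ->] := insert_row_sign hal lsort lz (leqnn n) (ltW b0).
  + by rewrite /= -wnE; apply: wlt; rewrite node_index_lt/=.
  + by rewrite ltnn.
  by rewrite addnn -signr_odd odd_double mul1r mulr_gt0// -wnE.
- split=> //; have [n' nE] : exists n', n = n'.+1 by exists n.-1; rewrite prednK.
  subst n.
  have [||l ln|_|c c0 ->] := @insert_row_sign _ _ _ _ _ n' (w n') hal esort ez.
  + exact: leqnSn.
  + by have /andP[] := wb n' (leqnSn _).
  + by rewrite /=; apply: wlt; rewrite node_index_lt/=.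
  + rewrite node_rows_value; last by rewrite /=; case: (odd n'); rewrite orbT.
    by rewrite /= addbN addbb addn1; split=> //; apply: wi.
  rewrite addnS addnn -signr_odd /= odd_double expr1 mulN1r mulrN oppr_lt0.
  by rewrite mulr_gt0.
Qed.

(** * Bottom lines and node sequences *)

Lemma monrowE (R : realType) (e z : R) (d : nat) :
  d = 0%N \/ d = 1%N /\ 0 < z -> derive1n d (monom e) z = monrow e (z, d).
Proof.
case=> [->//|[-> z0]]; rewrite /derive1n /= derive1E.
exact: (@derive_val _ _ _ _ _ _ _ (is_derive1_powR e z0)).
Qed.

Lemma ptmx_insert_row (R : realType) n (al : 'I_n.+1 -> R) (r : nat -> R * nat)
    (s : seq (R * nat)) (t : R) :
  sorted_rows r n -> (forall k, (k < n)%N -> nth (0, 0%N) s k = r k) ->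
  ptmx (fun i => monom (al i)) (pt t ++ s) = rowmx al (insert_row r 0 t).
Proof.
move=> [r0 d0 rn] sr; apply/matrixP => -[[|k] kn] i; rewrite !mxE /= /insert_row //=.
rewrite sr// monrowE; first by case: (r k).
case: k kn => [|k] kn; first by left.
by have [[-> _]|[-> -> _ ?]] := rn k kn; [left|right].
Qed.

(** Cramer's rule for the matrix with a variable first row: only the cofactors of
    that row occur, and they do not involve t. *)
Lemma peval_ptmx (R : realType) n (al g : 'I_n.+1 -> R) (r : nat -> R * nat)
    (s : seq (R * nat)) :
  exponents al -> sorted_rows r n -> (forall k, (k < n)%N -> nth (0, 0%N) s k = r k) ->
  (forall k, (k < n)%N -> peval al g (r k) = 0) ->
  exists2 D, 0 < D & forall t, peval al g (t, 0%N) =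
    (-1) ^+ n * (g ord_max / D) * \det (ptmx (fun i => monom (al i)) (pt t ++ s)).
Proof.
move=> hal hr sr gz; have D0 := det_rowmx_widen_gt0 hal hr.
exists (\det (rowmx (al \o lift ord_max) r)) => // t.
have := insert_row_cramer t (leq0n n) gz; rewrite -(ptmx_insert_row al t hr sr) add0n.
move=> E; apply: (mulfI (lt0r_neq0 D0)).
have cancel (c g' D d : R) : D != 0 -> D * (c * (g' / D) * d) = c * (d * g').
  by move=> ?; field.
by rewrite cancel ?lt0r_neq0// E mulrCA signrMK.
Qed.

Lemma dpts_recr (R : realType) (x : nat -> R) m :
  dpts x m.+1 = dpts x m ++ dpt (x m.+1).
Proof. by rewrite /dpts -[X in iota 1 X]addn1 iotaD map_cat flatten_cat add1n. Qed.

Lemma size_dpts (R : realType) (x : nat -> R) m : size (dpts x m) = m.*2.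
Proof. by elim: m => [//|m IHm]; rewrite dpts_recr size_cat IHm /= doubleS addn2. Qed.

Lemma nth_dpts (R : realType) (x : nat -> R) m k : (k < m.*2)%N ->
  nth (0, 0%N) (dpts x m) k = (x k./2.+1, odd k : nat).
Proof.
elim: m => [//|m IHm]; rewrite dpts_recr nth_cat size_dpts doubleS !ltnS.
case: ltnP => [/IHm //|mk]; rewrite leq_eqVlt => /predU1P[->|km].
  by rewrite subSn// subnn /= uphalf_double odd_double.
have -> : k = m.*2 by apply/eqP; rewrite eqn_leq mk -ltnS km.
by rewrite subnn /= doubleK odd_double.
Qed.

Lemma mem_dpts (R : realType) (x : nat -> R) m j :
  (0 < j <= m)%N -> (x j, 0%N) \in dpts x m.
Proof.
move=> jm; apply/flatten_mapP; exists j; first by rewrite mem_iota add1n ltnS.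
by rewrite inE eqxx.
Qed.

(** Doubled points stem from odd nodes (e = true), where they start at row 0, or from
    positive even nodes, where they come after the row of w_0. *)
Lemma node_rows_dpts (R : realType) (w x : nat -> R) (e : bool) m k :
  (forall j, (0 < j <= m)%N -> x j = w (j.*2 - e)%N) -> (k < m.*2)%N ->
  nth (0, 0%N) (dpts x m) k = node_rows e w (k + ~~ e).
Proof.
move=> xw km; rewrite nth_dpts// xw /=; last first.
  by rewrite -ltn_double (leq_ltn_trans _ km)// -[leqRHS]odd_double_half leq_addl.
have := odd_double_half k; move: (k./2) => h hk; rewrite -hk /node_rows.
congr (w _, nat_of_bool _).
  by rewrite !oddD odd_double; case: e {xw}; case: (odd k) => /=; lia.
by rewrite !oddD odd_double; case: e {xw}; case: (odd k) => //=; rewrite ?addn1 ?andbF.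
Qed.

Lemma alternate_recr (R : realType) (p q : nat -> R) m :
  alternate p q m.+1 = alternate p q m ++ [:: p m.+1; q m.+1].
Proof. by rewrite /alternate -[X in iota 1 X]addn1 iotaD map_cat flatten_cat add1n. Qed.

Lemma alternate_iota (R : realType) (p q w : nat -> R) m :
  (forall j, (0 < j <= m)%N -> p j = w j.*2.-1 /\ q j = w j.*2) ->
  alternate p q m = map w (iota 1 m.*2).
Proof.
elim: m => [//|m IHm] pqw; rewrite alternate_recr IHm => [|j /andP[j0 jm]].
  have [-> ->] := pqw m.+1 (leqnn _).
  by rewrite !doubleS -addn2 iotaD map_cat add1n addn2.
by apply: pqw; rewrite j0 leqW.
Qed.

Lemma path_iota (R : realType) (w : nat -> R) n :
  path <%R (w 0%N) (map w (iota 1 n)) <-> forall k, (k < n)%N -> w k < w k.+1.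
Proof.
have E : w 0%N :: map w (iota 1 n) = map w (iota 0 n.+1) by [].
split=> [/(pathP 0) H k kn|H].
  have := H k; rewrite size_map size_iota => /(_ kn).
  by rewrite E !(nth_map 0%N) ?size_iota ?nth_iota ?leqW.
apply/(pathP 0) => k; rewrite size_map size_iota => kn.
by rewrite E !(nth_map 0%N) ?size_iota ?nth_iota ?leqW //=; apply: H.
Qed.

(** * Existence *)

(** The property characterising the pair of the theorem, named so that existence and
    uniqueness can be stated apart. *)
Definition snake_decomposition (R : realType) (b : R) (n : nat)
    (alpha : 'I_n.+1 -> R) (f f_lo f_up : R -> R) : Prop :=
  let F := fun i : 'I_n.+1 => monom (alpha i) in
    [/\ lin F f_lo, lin F f_up, (forall t : R, f t = f_lo t + f_up t) &
      (exists m : nat, n = (2 * m)%N /\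
        exists (x y : nat -> R) (c_lo c_up : R),
          [/\ path <%R 0 (alternate x y m.-1 ++ [:: x m; b]),
              0 < c_lo, 0 < c_up &
              forall t : R, 0 <= t <= b ->
                [/\ f_lo t = c_lo * \det (ptmx F (pt t ++ dpts x m)),
                    0 <= f_lo t,
                    f_up t = - c_up *
                      \det (ptmx F (pt t ++ pt 0 ++ dpts y m.-1 ++ pt b)) &
                    0 <= f_up t]])
      \/
      (exists m : nat, n = (2 * m + 1)%N /\
        exists (x y : nat -> R) (c_lo c_up : R),
          [/\ path <%R 0 (alternate y x m ++ [:: b]),
              0 < c_lo, 0 < c_up &
              forall t : R, 0 <= t <= b ->
                [/\ f_lo t = - c_lo * \det (ptmx F (pt t ++ pt 0 ++ dpts x m)),
                    0 <= f_lo t,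
                    f_up t = c_up *
                      \det (ptmx F (pt t ++ dpts y m ++ pt b)) &
                    0 <= f_up t]])].

Lemma snake_decomposition_exists (R : realType) (b : R) n (al a : 'I_n.+1 -> R) (f : R -> R) :
  exponents al -> 0 < b -> (0 < n)%N ->
  (forall t, f t = peval al a (t, 0%N)) ->
  (forall t, 0 <= t <= b -> 0 < f t) ->
  exists f_lo f_up, snake_decomposition b al f f_lo f_up.
Proof.
move=> hal b0 n0 fE f0.
have [|p [u [w [pu pf [w0 wn wi] [lsort lz pmax] [esort ez umax]]]]] :=
  @snake_exists R n al a b hal b0 n0.
  by move=> t tb; rewrite -fE; apply: f0.
have fpu t : peval al a (t, 0%N) = peval al p (t, 0%N) + peval al u (t, 0%N).
  by rewrite /peval -big_split; apply: eq_bigr => i _; rewrite pu mulrDl.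
have pu0 t : 0 <= t <= b -> 0 <= peval al p (t, 0%N) /\ 0 <= peval al u (t, 0%N).
  by move=> /pf /andP[p0 pt]; split=> //; move: pt; rewrite fpu; lra.
exists (fun t => peval al p (t, 0%N)), (fun t => peval al u (t, 0%N)); split.
- by exists p.
- by exists u.
- by move=> t; rewrite fE fpu.
(* The odd nodes w_1, w_3, ... and the even nodes w_2, w_4, ..., both numbered
   from 1. *)
pose xo j := w (j.*2 - true)%N; pose xe j := w (j.*2 - false)%N.
have xoe j : (0 < j)%N -> xo j = w j.*2.-1 /\ xe j = w j.*2.
  by rewrite /xo /xe subn0 subn1.
have [no|ne] := boolP (odd n); [right|left].
  pose m := n./2; have nE : n = m.*2.+1 by rewrite -(odd_double_half n) no.
  exists m; split; first by rewrite {1}nE; lia.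
  have [D1 D10 h1] : exists2 D, 0 < D & forall t, peval al p (t, 0%N) =
      (-1) ^+ n * (p ord_max / D) *
      \det (ptmx (fun i => monom (al i)) (pt t ++ pt 0 ++ dpts xe m)).
    apply: (peval_ptmx hal lsort _ lz) => -[|k] kn /=.
      by rewrite node_rows_value// no /= w0.
    rewrite (@node_rows_dpts _ w xe false)//; first by rewrite no addn1.
    by rewrite -ltnS -nE.
  have [D2 D20 h2] : exists2 D, 0 < D & forall t, peval al u (t, 0%N) =
      (-1) ^+ n * (u ord_max / D) *
      \det (ptmx (fun i => monom (al i)) (pt t ++ dpts xo m ++ pt b)).
    apply: (peval_ptmx hal esort _ ez) => k kn.
    rewrite nth_cat size_dpts; case: ltnP => [km|mk].
      by rewrite (@node_rows_dpts _ w xo true)// no addn0.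
    have -> : k = m.*2 by lia.
    by rewrite subnn no node_rows_value ?odd_double ?orbT//= addn1 -nE wn.
  exists xe, xo, (p ord_max / D1), (- (u ord_max / D2)); split.
  - rewrite (@alternate_iota _ _ _ w) => [|j /andP[j0 _]]; last exact: xoe.
    rewrite -w0 -wn {1}nE -[[:: _]]/(map w [:: _]) -map_cat -[[:: _]]/(iota m.*2.+1 1).
    by rewrite -iotaD addn1; apply/path_iota => k km; apply: wi; rewrite nE.
  - by rewrite divr_gt0.
  - by rewrite oppr_gt0 pmulr_llt0 ?invr_gt0.
  move=> t tb; have [p0 u0] := pu0 t tb; split=> //.
  - by rewrite h1 -signr_odd no expr1 mulN1r.
  - by rewrite h2 -signr_odd no expr1 mulN1r.
pose m := n./2; have nE : n = m.*2 by rewrite -(odd_double_half n) (negbTE ne).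
have m0 : (0 < m)%N by lia.
exists m; split; first by rewrite {1}nE; lia.
have [D1 D10 h1] : exists2 D, 0 < D & forall t, peval al p (t, 0%N) =
    (-1) ^+ n * (p ord_max / D) *
    \det (ptmx (fun i => monom (al i)) (pt t ++ dpts xo m)).
  apply: (peval_ptmx hal lsort _ lz) => k kn.
  by rewrite (@node_rows_dpts _ w xo true) ?ne ?addn0 -?nE.
have [D2 D20 h2] : exists2 D, 0 < D & forall t, peval al u (t, 0%N) =
    (-1) ^+ n * (u ord_max / D) *
    \det (ptmx (fun i => monom (al i)) (pt t ++ pt 0 ++ dpts xe m.-1 ++ pt b)).
  apply: (peval_ptmx hal esort _ ez) => -[|k] kn /=.
    by rewrite node_rows_value// (negbTE ne) /= w0.
  rewrite nth_cat size_dpts; case: ltnP => [km|mk].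
    by rewrite (@node_rows_dpts _ w xe false)// (negbTE ne) addn1.
  have -> : k = m.-1.*2 by lia.
  rewrite subnn (negbTE ne) node_rows_value /= ?odd_double//= addn1 -wn.
  by congr (w _, _); lia.
exists xo, xe, (p ord_max / D1), (- (u ord_max / D2)); split.
- rewrite (@alternate_iota _ _ _ w) => [|j /andP[j0 _]]; last exact: xoe.
  have [-> _] := xoe m m0.
  rewrite -w0 -wn {1}nE -[[:: _; _]]/(map w [:: _; _]) -map_cat.
  have -> : [:: m.*2.-1; m.*2] = iota (1 + m.-1.*2) 2 by rewrite /=; congr [:: _; _]; lia.
  by rewrite -iotaD; apply/path_iota => k km; apply: wi; lia.
- by rewrite divr_gt0.
- by rewrite oppr_gt0 pmulr_llt0 ?invr_gt0.
move=> t tb; have [p0 u0] := pu0 t tb; split=> //.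
- by rewrite h1 -signr_odd (negbTE ne) expr0 mul1r.
- by rewrite h2 -signr_odd (negbTE ne) expr0 mul1r opprK.
Qed.

(** * Uniqueness *)

Lemma det_ptmx_repeat (R : realType) n (F : 'I_n.+1 -> R -> R) (s : seq (R * nat)) (t : R) :
  (size s <= n)%N -> (t, 0%N) \in s -> \det (ptmx F (pt t ++ s)) = 0.
Proof.
move=> sn ts; have ls : (index (t, 0%N) s < n)%N by apply: leq_trans sn; rewrite index_mem.
pose i1 : 'I_n.+1 := Ordinal (ls : (index (t, 0%N) s).+1 < n.+1)%N.
apply: (@determinant_alternate _ _ _ ord0 i1) => // j.
by rewrite !mxE /= nth_index.
Qed.

(** The n+1 contact points read off a decomposition: 0, then p_1, q_1, p_2, q_2, ...,
    and b at rank n. *)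
Definition merge_nodes (R : realType) n (b : R) (p q : nat -> R) (k : nat) : R :=
  if k == 0%N then 0 else if k == n then b else
  if odd k then p (uphalf k) else q k./2.

Lemma merge_nodes_alternate (R : realType) n m (b : R) (p q : nat -> R) :
  (m.*2 < n)%N -> alternate p q m = map (merge_nodes n b p q) (iota 1 m.*2).
Proof.
move=> mn; apply: alternate_iota => j /andP[j0 jm].
have jn : (j.*2 < n)%N by apply: leq_ltn_trans mn; rewrite leq_double.
case: j j0 {jm} jn => [//|j] _; rewrite /merge_nodes doubleS /= => jn.
by rewrite !ltn_eqF ?(ltnW jn)//= odd_double /= doubleK.
Qed.

(** The determinants vanish as soon as the variable point repeats a value row, which
    makes f_lo and f_up vanish in turn along 0 < x_1 < y_1 < ... < b (or
    0 < y_1 < x_1 < ... < b); the other one of the two equals f there. *)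
Lemma snake_decomposition_nodes (R : realType) (b : R) n (al a : 'I_n.+1 -> R)
    (f f_lo f_up : R -> R) :
  0 < b -> (0 < n)%N -> (forall t, f t = peval al a (t, 0%N)) ->
  snake_decomposition b al f f_lo f_up ->
  exists g, [/\ forall t, f_lo t = peval al g (t, 0%N),
    in_band al (fun t => peval al a (t, 0%N)) b g & alternating_contact al a g b].
Proof.
move=> b0 n0 fE [[g gE] _ fD hcase].
have gE' t : f_lo t = peval al g (t, 0%N) by rewrite gE.
exists g; split=> //.
  move=> t tb; rewrite -gE' -fE fD.
  by case: hcase => -[m [_ [x [y [c1 [c2 [_ _ _ /(_ t tb)[_ lo0 _ up0]]]]]]]];
    rewrite lo0 lerDl.
suff [p [q [wi wz]]] : exists p q : nat -> R, let w := merge_nodes n b p q in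
    path <%R 0 (map w (iota 1 n)) /\ forall k, (k <= n)%N -> 0 <= w k <= b ->
      if odd (k + n) then f_lo (w k) = 0 else f_up (w k) = 0.
  exists (merge_nodes n b p q).
  have w0 : merge_nodes n b p q 0 = 0 by [].
  have wn : merge_nodes n b p q n = b by rewrite /merge_nodes eqxx gtn_eqF.
  move: (merge_nodes n b p q) w0 wn wi wz => w w0 wn wi wz.
  have {}wi : forall k, (k < n)%N -> w k < w k.+1 by apply/path_iota; rewrite w0.
  split=> [||//|k kn]; rewrite ?w0 ?wn//.
  have wb : 0 <= w k <= b by apply: (increasing_within _ _ wi); rewrite ?w0 ?wn.
  have := wz k kn wb; rewrite -gE' -fE fD; case: odd => // ->.
  by rewrite addr0.
case: hcase => -[m [nE [x [y [c1 [c2 [hpath _ _ hdet]]]]]]].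
- exists x, y; move=> w; have m0 : (0 < m)%N by lia.
  split.
    move: hpath; rewrite (@merge_nodes_alternate _ n _ b); last by lia.
    have -> : [:: x m; b] = map w (iota (1 + m.-1.*2) 2).
      rewrite /= /w /merge_nodes.
      have -> : ((1 + m.-1.*2).+1 == n) by apply/eqP; lia.
      have -> : (1 + m.-1.*2 == n)%N = false by apply/eqP; lia.
      by rewrite /= odd_double /= doubleK prednK.
    by rewrite -map_cat -iotaD (_ : (m.-1.*2 + 2)%N = n) //; lia.
  move=> k kn wb; have [-> _ -> _] := hdet _ wb.
  have no : odd n = false by rewrite nE mul2n odd_double.
  rewrite oddD no addbF; case: ifP => ko.
    rewrite det_ptmx_repeat ?mulr0 ?size_dpts//; first by lia.
    have kn' : k != n by apply/eqP => kE; rewrite -kE ko in no.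
    have k0 : k != 0%N by case: k ko {kn wb kn'}.
    rewrite /w /merge_nodes (negbTE k0) (negbTE kn') ko; apply: mem_dpts.
    have := odd_double_half k; rewrite uphalf_half ko; lia.
  rewrite det_ptmx_repeat ?mulr0//; first by rewrite !size_cat size_dpts /=; lia.
  rewrite /w /merge_nodes !mem_cat /pt !inE.
  have [//|k0] := eqVneq k 0%N; first by rewrite eqxx.
  have [//|kn'] := eqVneq k n; first by rewrite eqxx !orbT.
  rewrite ko mem_dpts ?orbT//.
  have := odd_double_half k; rewrite ko; move/eqP: k0; move/eqP: kn'; lia.
exists y, x; move=> w; split.
  move: hpath; rewrite (@merge_nodes_alternate _ n _ b); last by lia.
  have -> : [:: b] = map w (iota (1 + m.*2) 1).
    rewrite /= /w /merge_nodes.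
    by have -> : (1 + m.*2 == n)%N by apply/eqP; lia.
  by rewrite -map_cat -iotaD (_ : (m.*2 + 1)%N = n) //; lia.
move=> k kn wb; have [-> _ -> _] := hdet _ wb.
have no : odd n by rewrite nE mul2n addn1 /= odd_double.
rewrite oddD no addbT; case: ifP => ko; last first.
  rewrite det_ptmx_repeat ?mulr0//; first by rewrite !size_cat size_dpts /=; lia.
  move/negbFE: ko => ko.
  have k0 : k != 0%N by case: k ko {kn wb}.
  rewrite /w /merge_nodes !mem_cat /pt !inE (negbTE k0).
  have [//|kn'] := eqVneq k n; first by rewrite eqxx !orbT.
  rewrite ko mem_dpts//.
  have := odd_double_half k; rewrite uphalf_half ko; move/eqP: kn'; lia.
rewrite det_ptmx_repeat ?mulr0//; first by rewrite !size_cat size_dpts /=; lia.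
have kn' : k != n by apply/eqP => kE; rewrite kE no in ko.
rewrite /w /merge_nodes !mem_cat /pt !inE (negbTE kn') (negbTE ko).
have [//|k0] := eqVneq k 0%N; first by rewrite eqxx.
rewrite mem_dpts ?orbT//.
have := odd_double_half k; rewrite (negbTE ko); move/eqP: k0; lia.
Qed.

Lemma snake_decomposition_unique (R : realType) (b : R) n (al a : 'I_n.+1 -> R)
    (f f_lo f_up g_lo g_up : R -> R) :
  exponents al -> 0 < b -> (0 < n)%N -> (forall t, f t = peval al a (t, 0%N)) ->
  snake_decomposition b al f f_lo f_up -> snake_decomposition b al f g_lo g_up ->
  f_lo = g_lo /\ f_up = g_up.
Proof.
move=> hal b0 n0 fE hf hg.
have [p [pE pb [w [w0 wn wi pw]]]] := snake_decomposition_nodes b0 n0 fE hf.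
have [q [qE qb [v [v0 vn vi qv]]]] := snake_decomposition_nodes b0 n0 fE hg.
have [qp pqE] := snake_extremal hal w0 wi pw (fun k kn => qb _ (increasing_within w0 wn wi kn)).
have [pq _] := snake_extremal hal v0 vi qv (fun k kn => pb _ (increasing_within v0 vn vi kn)).
have {}pqE : p = q by apply/funext; apply: pqE; apply/eqP; rewrite eq_le qp pq.
have loE : f_lo = g_lo by apply/funext => t; rewrite pE qE pqE.
split=> //; apply/funext => t.
have [_ _ fD _] := hf; have [_ _ gD _] := hg.
by apply: (@addrI _ (f_lo t)); rewrite -fD loE -gD.
Qed.

Unset Implicit Arguments.

Theorem corollary5p2p2 (R : realType) (b : R) (hb : 0 < b)
  (n : nat) (hn : (0 < n)%N)
  (alpha : 'I_n.+1 -> R) (halpha0 : alpha ord0 = 0)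
  (halpha : forall i j : 'I_n.+1, (i < j)%N -> alpha i < alpha j)
  (a : 'I_n.+1 -> R) (f : R -> R)
  (hf : forall t : R, f t = \sum_(i < n.+1) a i * monom (alpha i) t)
  (hfpos : forall t : R, 0 <= t <= b -> 0 < f t)
  (han : 0 < a ord_max) :
  let F := fun i : 'I_n.+1 => monom (alpha i) in
  exists! d : (R -> R) * (R -> R),
    let: (f_lo, f_up) := d in
    [/\ lin F f_lo, lin F f_up, (forall t : R, f t = f_lo t + f_up t) &
      (exists m : nat, n = (2 * m)%N /\
        exists (x y : nat -> R) (c_lo c_up : R),
          [/\ path <%R 0 (alternate x y m.-1 ++ [:: x m; b]),
              0 < c_lo, 0 < c_up &
              forall t : R, 0 <= t <= b ->
                [/\ f_lo t = c_lo * \det (ptmx F (pt t ++ dpts x m)),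
                    0 <= f_lo t,
                    f_up t = - c_up *
                      \det (ptmx F (pt t ++ pt 0 ++ dpts y m.-1 ++ pt b)) &
                    0 <= f_up t]])
      \/
      (exists m : nat, n = (2 * m + 1)%N /\
        exists (x y : nat -> R) (c_lo c_up : R),
          [/\ path <%R 0 (alternate y x m ++ [:: b]),
              0 < c_lo, 0 < c_up &
              forall t : R, 0 <= t <= b ->
                [/\ f_lo t = - c_lo * \det (ptmx F (pt t ++ pt 0 ++ dpts x m)),
                    0 <= f_lo t,
                    f_up t = c_up *
                      \det (ptmx F (pt t ++ dpts y m ++ pt b)) &
                    0 <= f_up t]])].
Proof.
move=> F; have hal : exponents alpha by [].
have fE t : f t = peval alpha a (t, 0%N) by rewrite hf.
have [f_lo [f_up hd]] := snake_decomposition_exists hal hb hn fE hfpos.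
exists (f_lo, f_up); split=> [|[g_lo g_up] hd']; first exact: hd.
by have [-> ->] := snake_decomposition_unique hal hb hn fE hd hd'.
Qed.
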